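(* Let $p$ be a prime and let $\mathcal{F}$ be a constrained saturated fusion system over a finite $p$-group $S$. Then there is a unique (up to isomorphism) finite $p'$-reduced $p$-constrained group $G$, containing $S$ as a Sylow $p$-subgroup, such that $\mathcal{F}=\mathcal{F}_S(G)$ as fusion systems over $S$. Furthermore, if $\mathcal{L}$ is a centric linking system associated to $\mathcal{F}$, then (a) $G\cong\mathrm{Aut}_{\mathcal{L}}(Q)$ for any subgroup $Q\trianglelefteq S$ which is $\mathcal{F}$-centric and normal in $\mathcal{F}$; and (b) $\mathcal{L}\cong\mathcal{L}_S^c(G)$.
   Context: For subgroups $P,Q$ of a group $G$: $c_x$ denotes conjugation $g\mapsto xgx^{-1}$; $N_G(P,Q)=\{x\in G\mid xPx^{-1}\le Q\}$; $\mathrm{Hom}_G(P,Q)$ is the set of homomorphisms $P\to Q$ induced by conjugation by elements of $G$; $\mathrm{Aut}_G(P)=\mathrm{Hom}_G(P,P)$; $\mathrm{Inj}(P,Q)$ is the set of injective homomorphisms. A fusion system $\mathcal{F}$ over a finite $p$-group $S$ is a category whose objects are all subgroups of $S$, whose morphisms are group homomorphisms, such that for all $P,Q\le S$: $\mathrm{Hom}_S(P,Q)\subseteq \mathrm{Hom}_{\mathcal{F}}(P,Q)\subseteq \mathrm{Inj}(P,Q)$, and each $\varphi\in\mathrm{Hom}_{\mathcal{F}}(P,Q)$ is the composite of an isomorphism in $\mathcal{F}$ followed by an inclusion. $\mathrm{Aut}_{\mathcal{F}}(P)=\mathrm{Hom}_{\mathcal{F}}(P,P)$. Subgroups are $\mathcal{F}$-conjugate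 if isomorphic in $\mathcal{F}$. $P$ is $\mathcal{F}$-centric if $C_S(P')=Z(P')$ for all $P'$ $\mathcal{F}$-conjugate to $P$; fully centralized (fully normalized) if $|C_S(P)|\ge|C_S(P')|$ ($|N_S(P)|\ge|N_S(P')|$) for all $P'$ $\mathcal{F}$-conjugate to $P$. $\mathcal{F}$ is saturated if for all $P\le S$: (I) if $P$ is fully normalized then $P$ is fully centralized and $\mathrm{Aut}_S(P)\in\mathrm{Syl}_p(\mathrm{Aut}_{\mathcal{F}}(P))$; (II) if $\varphi\in\mathrm{Hom}_{\mathcal{F}}(P,S)$ and $\varphi(P)$ is fully centralized, then $\varphi$ extends to some $\overline\varphi\in\mathrm{Hom}_{\mathcal{F}}(N_\varphi,S)$, where $N_\varphi=\{g\in N_S(P)\mid \varphi c_g\varphi^{-1}\in\mathrm{Aut}_S(\varphi(P))\}$. $Q\trianglelefteq S$ is normal in $\mathcal{F}$ if each $\alpha\in\mathrm{Hom}_{\mathcal{F}}(P,P')$ extends to some $\overline{\alpha}\in\mathrm{Hom}_{\mathcal{F}}(PQ,P'Q)$ with $\overline{\alpha}(Q)=Q$. A saturated $\mathcal{F}$ is constrained if there is some $Q\trianglelefteq S$ which is $\mathcal{F}$-centric and normal in $\mathcal{F}$. $\mathcal{F}^c\subseteq\mathcal{F}$ is the full subcategory on the $\mathcal{F}$-centric subgroups. A centric linking system associated to $\mathcal{F}$ is a category $\mathcal{L}$ whose objects are the $\mathcal{F}$-centric subgroups of $S$, with a functor $\pi:\mathcal{L}\to\mathcal{F}^c$ and monomorphisms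 $\delta_P:P\to\mathrm{Aut}_{\mathcal{L}}(P)$, such that: (A) $\pi$ is the identity on objects, and for all $P,Q$, $Z(P)$ acts freely on $\mathrm{Mor}_{\mathcal{L}}(P,Q)$ by composition (via $\delta_P$) and $\pi$ induces a bijection $\mathrm{Mor}_{\mathcal{L}}(P,Q)/Z(P)\cong\mathrm{Hom}_{\mathcal{F}}(P,Q)$; (B) $\pi(\delta_P(x))=c_x$ for $x\in P$; (C) $f\circ\delta_P(x)=\delta_Q(\pi(f)(x))\circ f$ for $f\in\mathrm{Mor}_{\mathcal{L}}(P,Q)$, $x\in P$. Isomorphisms of centric linking systems are isomorphisms of categories commuting with the projection functors and the distinguished monomorphisms $\delta_P$. For a finite group $G$ with Sylow $p$-subgroup $S$: $\mathcal{F}_S(G)$ is the fusion system over $S$ with $\mathrm{Hom}_{\mathcal{F}_S(G)}(P,Q)=\mathrm{Hom}_G(P,Q)$. $\mathcal{L}_S^c(G)$ is the centric linking system associated to $\mathcal{F}_S(G)$ whose objects are the $\mathcal{F}_S(G)$-centric subgroups of $S$ (equivalently, those $P\le S$ with $Z(P)\in\mathrm{Syl}_p(C_G(P))$), with $\mathrm{Mor}(P,Q)=N_G(P,Q)/O^p(C_G(P))$, where $O^p(H)$ is the subgroup generated by the elements of $H$ of order prime to $p$; the projection functor sends the class of $x$ to $c_x$, and $\delta_P$ sends $g\in P$ to its class. A finite group $G$ is $p'$-reduced if it has no nontrivial normal subgroup of order prime to $p$; a $p'$-reduced finite group $G$ is $p$-constrained if there is a normal $p$-subgroup $P\trianglelefteq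 G$ with $C_G(P)\le P$. *)

(* Defs.v *)
From mathcomp Require Import all_boot all_fingroup all_solvable.

Set Implicit Arguments.
Unset Strict Implicit.
Unset Printing Implicit Defensive.

Local Open Scope group_scope.

(* Conventions.
   - The p-group S is a whole finGroupType, so its subgroups are the P : {group S},
     and C_S(P), N_S(P) are 'C(P), 'N(P).
   - Maps P -> Q are finite functions between the subgroup types [subg P] and
     [subg Q], hence extensional, with a finite type of maps.
   - Left actions: c_x(g) = x g x^-1, which is g ^ x^-1 for MathComp's ^. *)

(* The finType of all set maps P -> Q; the homomorphisms are singled out by Inj. *)
Notation "P ~> Q" := {ffun subg_of P -> subg_of Q}
  (at level 55, no associativity) : type_scope.

Section Maps.

Variable S : finGroupType.
Implicit Types P Q R : {group S}.

Definition fid P : P ~> P := [ffun u => u].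

Definition fcomp P Q R (psi : Q ~> R) (phi : P ~> Q) : P ~> R :=
  [ffun u => psi (phi u)].

(* The inclusion map; only meaningful when P \subset Q. *)
Definition fincl P Q : P ~> Q := [ffun u => subg Q (sgval u)].

Definition Inj P Q : {set P ~> Q} :=
  [set phi : P ~> Q | injectiveb phi
                      && [forall u, forall v, phi (u * v) == phi u * phi v]].

Definition fimset P Q (phi : P ~> Q) (A : {set S}) : {set S} :=
  [set sgval (phi u) | u : subg_of P & sgval u \in A].

(* The image phi(P). For a homomorphism phi the set is already a group
   (see fimE), and << >> only packages it as one. *)
Definition fim P Q (phi : P ~> Q) : {group S} := <<fimset phi P>>%G.

(* psi : R -> R' extends phi : P -> P'; only meaningful when P \subset R. *)
Definition extends P P' R R' (psi : R ~> R') (phi : P ~> P') : Prop :=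
  forall x : S, x \in P -> sgval (psi (subg R x)) = sgval (phi (subg P x)).

(* Hom_G(P,Q), for S seen inside G through i. *)
Definition hom_conj (G : finGroupType) (i : S -> G) P Q : {set P ~> Q} :=
  [set phi : P ~> Q |
    [exists x, [forall u, i (sgval (phi u)) == i (sgval u) ^ x^-1]]].

Definition homS P Q : {set P ~> Q} := hom_conj (fun x : S => x) P Q.

Definition isos_in (hom : forall P Q, {set P ~> Q}) P Q : {set P ~> Q} :=
  [set phi in hom P Q |
    [exists psi in hom Q P, (fcomp psi phi == fid P) && (fcomp phi psi == fid Q)]].

Lemma fcompE P Q R (psi : Q ~> R) (phi : P ~> Q) u : fcomp psi phi u = psi (phi u).
Proof. by rewrite ffunE. Qed.

Lemma fcompA P Q R T (chi : R ~> T) (psi : Q ~> R) (phi : P ~> Q) :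
  fcomp chi (fcomp psi phi) = fcomp (fcomp chi psi) phi.
Proof. by apply/ffunP=> u; rewrite !ffunE. Qed.

Lemma fcomp1f P Q (phi : P ~> Q) : fcomp (fid Q) phi = phi.
Proof. by apply/ffunP=> u; rewrite !ffunE. Qed.

Lemma fcompf1 P Q (phi : P ~> Q) : fcomp phi (fid P) = phi.
Proof. by apply/ffunP=> u; rewrite !ffunE. Qed.

Lemma InjP P Q (phi : P ~> Q) :
  reflect (injective phi /\ {morph phi : u v / u * v}) (phi \in Inj P Q).
Proof.
rewrite inE; apply: (iffP andP) => -[/injectiveP injphi] phiM; split=> //.
  by move=> u v; move/forallP/(_ u)/forallP/(_ v)/eqP: phiM.
by apply/forallP=> u; apply/forallP=> v; rewrite phiM.
Qed.

Lemma fimE P Q (phi : P ~> Q) : phi \in Inj P Q -> fim phi :=: fimset phi P.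
Proof.
case/InjP=> _ phiM; have phi1 : phi 1 = 1.
  by apply: (mulIg (phi 1)); rewrite -phiM !mul1g.
rewrite /fim /= gen_set_id //; apply/group_setP; split.
  apply/imsetP; exists 1; first by rewrite inE subgP.
  by rewrite phi1.
move=> _ _ /imsetP[u _ ->] /imsetP[v _ ->]; apply/imsetP.
by exists (u * v); [rewrite inE subgP | rewrite phiM].
Qed.

End Maps.

Arguments fid {S} P.
Arguments fincl {S} P Q.
Arguments homS {S} P Q.

(* Every subgroup of S is an object, so only the morphism sets are data. *)
Record fusion_system (S : finGroupType) := FusionSystem {
  fhom : forall P Q : {group S}, {set P ~> Q};
  fhom_id : forall P, fid P \in fhom P P;
  fhom_comp : forall (P Q R : {group S}) (psi : Q ~> R) (phi : P ~> Q),
    psi \in fhom Q R -> phi \in fhom P Q -> fcomp psi phi \in fhom P R;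
  fhom_homS : forall P Q, homS P Q \subset fhom P Q;
  fhom_Inj : forall P Q, fhom P Q \subset Inj P Q;
  fhom_fact : forall (P Q : {group S}) (phi : P ~> Q), phi \in fhom P Q ->
    exists (R : {group S}) (psi : P ~> R),
      [/\ psi \in isos_in fhom P R, R \subset Q & phi = fcomp (fincl R Q) psi]
}.

Definition fusion_eq (S : finGroupType) (F F' : fusion_system S) : Prop :=
  forall P Q, fhom F P Q = fhom F' P Q.

Section FusionSystem.

Variables (S : finGroupType) (F : fusion_system S).
Implicit Types P Q : {group S}.

Definition fconj P Q : bool := isos_in (fhom F) P Q != set0.

Definition centric P : bool :=
  [forall P' : {group S}, fconj P P' ==> ('C(P') == 'Z(P') :> {set S})].

Definition fully_centralized P : bool :=
  [forall P' : {group S}, fconj P P' ==> (#|'C(P')| <= #|'C(P)|)].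

Definition fully_normalized P : bool :=
  [forall P' : {group S}, fconj P P' ==> (#|'N(P')| <= #|'N(P)|)].

(* Aut_F(P) and Aut_S(P), as sets of permutations of P. MathComp's product of
   permutations is composition in the reverse order; being a subgroup, and being
   a Sylow subgroup, do not depend on that order. *)
Definition AutF P : {set {perm subg_of P}} :=
  [set a : {perm subg_of P} | [ffun u => a u] \in fhom F P P].

Definition AutS P : {set {perm subg_of P}} :=
  [set a : {perm subg_of P} | [ffun u => a u] \in homS P P].

(* phi c_g phi^-1 \in Aut_S(phi(P)) means that phi c_g phi^-1 and some c_h agree
   on phi(P), that is, phi (c_g u) = c_h (phi u) for all u in P. *)
Definition Nphi_set P Q (phi : P ~> Q) : {set S} :=
  [set g in 'N(P) | [exists h : S, [forall u : subg_of P,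
     sgval (phi (subg P (sgval u ^ g^-1))) == sgval (phi u) ^ h^-1]]].

(* The set is already a group (see NphiE). *)
Definition Nphi P Q (phi : P ~> Q) : {group S} := <<Nphi_set phi>>%G.

Definition saturated (p : nat) : Prop :=
  forall P,
    (fully_normalized P -> fully_centralized P /\ p.-Sylow(AutF P) (AutS P))
    /\ (forall phi : P ~> [set: S], phi \in fhom F P [set: S]%G ->
          fully_centralized (fim phi) ->
          exists2 phibar : Nphi phi ~> [set: S],
            phibar \in fhom F (Nphi phi) [set: S]%G & extends phibar phi).

Definition fnormal Q : Prop :=
  Q <| [set: S] /\
  forall P P' (alpha : P ~> P'), alpha \in fhom F P P' ->
    exists abar : (P <*> Q)%G ~> (P' <*> Q)%G,
      [/\ abar \in fhom F (P <*> Q)%G (P' <*> Q)%G, extends abar alpha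
        & fimset abar Q = Q].

Definition constrained : Prop := exists Q, centric Q /\ fnormal Q.

Lemma AutF_group_set P : group_set (AutF P).
Proof.
apply/group_setP; split=> [|a b].
  rewrite inE; have -> : [ffun u => (1 : {perm subg_of P}) u] = fid P.
    by apply/ffunP=> u; rewrite !ffunE perm1.
  exact: fhom_id.
rewrite !inE => Fa Fb.
have -> : [ffun u => (a * b) u] = fcomp [ffun u => b u] [ffun u => a u] :> (P ~> P).
  by apply/ffunP=> u; rewrite !ffunE permM.
exact: fhom_comp.
Qed.
Canonical AutF_group P := Group (AutF_group_set P).

Lemma AutS_group_set P : group_set (AutS P).
Proof.
apply/group_setP; split=> [|a b].
  rewrite !inE; apply/existsP; exists 1; apply/forallP=> u.
  by rewrite ffunE perm1 invg1 conjg1.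
rewrite !inE => /existsP[x /forallP ax] /existsP[y /forallP bY].
apply/existsP; exists (y * x); apply/forallP=> u.
move: (ax u) (bY (a u)); rewrite !ffunE permM => /eqP eax /eqP ->.
by rewrite eax -conjgM invMg.
Qed.
Canonical AutS_group P := Group (AutS_group_set P).

Lemma AutS_sub_AutF P : AutS P \subset AutF P.
Proof.
apply/subsetP=> a; rewrite [a \in AutS _]inE [a \in AutF _]inE.
exact: (subsetP (fhom_homS F P P)).
Qed.

Lemma NphiE P Q (phi : P ~> Q) : Nphi phi :=: Nphi_set phi.
Proof.
rewrite /Nphi /= gen_set_id //; apply/group_setP; split.
  rewrite [_ \in Nphi_set _]inE group1; apply/existsP; exists 1.
  by apply/forallP=> u; rewrite invg1 !conjg1 sgvalK.
move=> g g'; rewrite ![_ \in Nphi_set _]inE => /andP[Ng /existsP[h /forallP Hh]].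
case/andP=> Ng' /existsP[h' /forallP Hh']; rewrite groupM //=.
apply/existsP; exists (h * h'); apply/forallP=> u.
have Pu : sgval u ^ g'^-1 \in P by rewrite memJ_norm ?groupV // subgP.
move: (Hh (subg P (sgval u ^ g'^-1))) (Hh' u); rewrite subgK //.
by rewrite !invMg !conjgM => /eqP -> /eqP ->.
Qed.

End FusionSystem.

(* Categories with object type O. *)
Record category (O : Type) := Category {
  mor : O -> O -> Type;
  cid : forall P, mor P P;
  ccomp : forall P Q R, mor Q R -> mor P Q -> mor P R;
  ccompA : forall P Q R T (h : mor R T) (g : mor Q R) (f : mor P Q),
    ccomp h (ccomp g f) = ccomp (ccomp h g) f;
  ccomp1f : forall P Q (f : mor P Q), ccomp (cid Q) f = f;
  ccompf1 : forall P Q (f : mor P Q), ccomp f (cid P) = f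
}.

(* Functors that are the identity on objects. *)
Record functor (O : Type) (C D : category O) := Functor {
  fmap : forall P Q, mor C P Q -> mor D P Q;
  fmap_id : forall P, fmap (cid C P) = cid D P;
  fmap_comp : forall P Q R (g : mor C Q R) (f : mor C P Q),
    fmap (ccomp g f) = ccomp (fmap g) (fmap f)
}.

Definition cat_iso (O : Type) (C : category O) (P Q : O) (f : mor C P Q) : Prop :=
  exists g : mor C Q P, ccomp g f = cid C P /\ ccomp f g = cid C Q.

(* G is isomorphic to the group Aut_C(P) of invertible endomorphisms of P. *)
Definition isog_Aut (G : finGroupType) (O : Type) (C : category O) (P : O) : Prop :=
  exists theta : G -> mor C P P,
    [/\ forall x y, theta (x * y) = ccomp (theta x) (theta y),
        injective theta
      & forall f : mor C P P, cat_iso f <-> exists x, theta x = f].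

Section LinkingSystem.

Variables (S : finGroupType) (F : fusion_system S).

Definition cobj := {P : {group S} | centric F P}.

Definition Fc_mor (P Q : cobj) := {phi : val P ~> val Q | phi \in fhom F (val P) (val Q)}.

Definition Fc_id (P : cobj) : Fc_mor P P := exist _ (fid (val P)) (fhom_id F (val P)).

Definition Fc_comp (P Q R : cobj) (g : Fc_mor Q R) (f : Fc_mor P Q) : Fc_mor P R :=
  exist _ (fcomp (val g) (val f)) (fhom_comp (valP g) (valP f)).

Definition Fc : category cobj.
Proof.
apply: (@Category _ Fc_mor Fc_id Fc_comp) => *; apply: val_inj => /=.
- exact: fcompA.
- exact: fcomp1f.
- exact: fcompf1.
Defined.

Record linking_system := LinkingSystem {
  lcat :> category cobj;
  lpi : functor lcat Fc;
  ldelta : forall P : cobj, subg_of (val P) -> mor lcat P P;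
  (* Multiplicativity and ldelta1 make each ldelta x invertible, so ldelta is a
     monomorphism of groups from P into Aut_L(P). *)
  ldelta1 : forall P, ldelta (1 : subg_of (val P)) = cid lcat P;
  ldeltaM : forall P (x y : subg_of (val P)),
    ldelta (x * y) = ccomp (ldelta x) (ldelta y);
  ldelta_inj : forall P, injective (@ldelta P);
  lZ_free : forall (P Q : cobj) (f : mor lcat P Q) (z : subg_of (val P)),
    sgval z \in 'Z(val P) -> ccomp f (ldelta z) = f -> z = 1;
  (* lpi_surj and lpi_orbit: lpi induces a bijection from Mor(P,Q)/Z(P) onto
     Hom_F(P,Q), where z acts by precomposition with ldelta z. *)
  lpi_surj : forall (P Q : cobj) (phi : mor Fc P Q),
    exists f : mor lcat P Q, fmap lpi f = phi;
  lpi_orbit : forall (P Q : cobj) (f g : mor lcat P Q),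
    fmap lpi f = fmap lpi g <->
    exists2 z : subg_of (val P), sgval z \in 'Z(val P) & g = ccomp f (ldelta z);
  lpi_delta : forall (P : cobj) (x u : subg_of (val P)),
    val (fmap lpi (ldelta x)) u = u ^ x^-1;
  lcompC : forall (P Q : cobj) (f : mor lcat P Q) (x : subg_of (val P)),
    ccomp f (ldelta x) = ccomp (ldelta (val (fmap lpi f) x)) f
}.

(* An isomorphism of categories commuting with the projections, which are the
   identity on objects, is itself the identity on objects. *)
Definition linking_iso (L L' : linking_system) : Prop :=
  exists Phi : functor L L',
    [/\ forall P Q, bijective (@fmap _ _ _ Phi P Q),
        forall P Q (f : mor L P Q), fmap (lpi L') (fmap Phi f) = fmap (lpi L) f
      & forall P (x : subg_of (val P)), fmap Phi (ldelta L x) = ldelta L' x].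

End LinkingSystem.

(* "G contains S as a Sylow p-subgroup". *)
Record sylow_embedding (p : nat) (S G : finGroupType) := SylowEmbedding {
  semb : {morphism [set: S] >-> G};
  semb_inj : 'injm semb;
  semb_sylow : p.-Sylow([set: G]) (semb @* [set: S])
}.

Definition p'_reduced (p : nat) (G : finGroupType) : Prop :=
  forall N : {group G}, N <| [set: G] -> p^'.-group N -> N :=: 1.

Definition p_constrained (p : nat) (G : finGroupType) : Prop :=
  exists2 P : {group G}, P <| [set: G] & p.-group P && ('C(P) \subset P).

(* O^p(H), generated by the p'-elements; not the p-core 'O_p(H). *)
Definition Op_upper (p : nat) (G : finGroupType) (H : {set G}) : {set G} :=
  <<[set x in H | p^'.-elt x]>>.

(* N_G(P,Q) *)
Definition transporter (G : finGroupType) (P Q : {set G}) : {set G} :=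
  [set x | P :^ x^-1 \subset Q].

(* The map c_x : P -> Q for x \in N_G(P,Q); meaningless for other x. *)
Definition cmap (p : nat) (S G : finGroupType) (e : sylow_embedding p S G)
    (P Q : {group S}) (x : G) : P ~> Q :=
  [ffun u => subg Q (invm (semb_inj e) (semb e (sgval u) ^ x^-1))].

Section SylowEmbedding.

Variables (p : nat) (S G : finGroupType) (e : sylow_embedding p S G).
Local Notation i := (semb e).

Lemma semb_injective : injective i.
Proof. by move=> x y exy; apply: (injmP (semb_inj e)); rewrite ?inE. Qed.

Lemma sembM x y : i (x * y) = i x * i y.
Proof. by rewrite morphM ?inE. Qed.

Lemma mem_semb (P : {group S}) u : (i u \in i @* P) = (u \in P).
Proof.
apply/idP/idP=> [/morphimP[v _ Pv /semb_injective-> //] | Pu].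
by rewrite mem_morphim ?inE.
Qed.

End SylowEmbedding.

Section FusionOfGroup.

Variables (p : nat) (S G : finGroupType) (e : sylow_embedding p S G).
Implicit Types P Q : {group S}.

Local Notation i := (semb e).
Local Notation injI := (@semb_injective p S G e).
Local Notation morI := (@sembM p S G e).

Lemma FSG_id P : fid P \in hom_conj i P P.
Proof.
by rewrite inE; apply/existsP; exists 1; apply/forallP=> u; rewrite ffunE invg1 conjg1.
Qed.

Lemma FSG_comp (P Q R : {group S}) (psi : Q ~> R) (phi : P ~> Q) :
  psi \in hom_conj i Q R -> phi \in hom_conj i P Q -> fcomp psi phi \in hom_conj i P R.
Proof.
rewrite !inE => /existsP[y /forallP ey] /existsP[x /forallP ex].
apply/existsP; exists (y * x); apply/forallP=> u.
by rewrite ffunE (eqP (ey _)) (eqP (ex _)) invMg conjgM.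
Qed.

Lemma FSG_homS P Q : homS P Q \subset hom_conj i P Q.
Proof.
apply/subsetP=> phi; rewrite !inE => /existsP[x /forallP ex].
apply/existsP; exists (i x); apply/forallP=> u; rewrite (eqP (ex u)).
by rewrite morphJ ?morphV ?inE.
Qed.

Lemma FSG_Inj P Q : hom_conj i P Q \subset Inj P Q.
Proof.
apply/subsetP=> phi; rewrite [phi \in hom_conj _ _ _]inE => /existsP[x /forallP ex].
apply/InjP; split=> [u v euv | u v].
  apply: subg_inj; apply: injI; apply: (conjg_inj x^-1).
  by rewrite -(eqP (ex u)) -(eqP (ex v)) euv.
apply: subg_inj; apply: injI.
by rewrite (eqP (ex _)) /= !morI (eqP (ex u)) (eqP (ex v)) conjMg.
Qed.

Lemma FSG_fact (P Q : {group S}) (phi : P ~> Q) : phi \in hom_conj i P Q ->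
  exists (R : {group S}) (psi : P ~> R),
    [/\ psi \in isos_in (hom_conj i) P R, R \subset Q & phi = fcomp (fincl R Q) psi].
Proof.
move=> Hphi; have Jphi := subsetP (FSG_Inj P Q) _ Hphi.
move: Hphi; rewrite inE => /existsP[x /forallP ex].
have Rphi u : sgval (phi u) \in fim phi.
  by rewrite fimE //; apply/imsetP; exists u; rewrite ?inE ?subgP.
have sRQ : fim phi \subset Q.
  by rewrite fimE //; apply/subsetP=> _ /imsetP[u _ ->]; apply: subgP.
have fimP r : r \in fim phi -> exists u, sgval (phi u) = r.
  by rewrite fimE // => /imsetP[u _ ->]; exists u.
pose psi : P ~> fim phi := [ffun u => subg (fim phi) (sgval (phi u))].
exists (fim phi), psi; split=> //; last first.
  by apply/ffunP=> u; apply: subg_inj; rewrite !ffunE !subgK ?subgP // sgvalK.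
pose chi : fim phi ~> P := [ffun r => odflt 1 [pick u | sgval (phi u) == sgval r]].
have chiE (r : subg_of (fim phi)) : sgval (phi (chi r)) = sgval r.
  rewrite ffunE; case: pickP => [u /eqP //|no].
  by have [u def_r] := fimP _ (subgP r); have := no u; rewrite /= def_r eqxx.
have injphi : injective phi by case/InjP: Jphi.
rewrite inE; apply/andP; split.
  by rewrite inE; apply/existsP; exists x; apply/forallP=> u; rewrite ffunE subgK // ex.
apply/existsP; exists chi; apply/and3P; split.
- rewrite inE; apply/existsP; exists x^-1; apply/forallP=> r.
  by rewrite -(chiE r) (eqP (ex _)) -conjgM mulgV conjg1.
- apply/eqP/ffunP=> u; apply: injphi; apply: subg_inj.
  by rewrite fcompE chiE !ffunE subgK.
apply/eqP/ffunP=> r; apply: subg_inj.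
by rewrite fcompE [psi _]ffunE subgK // chiE ffunE.
Qed.

Definition FSG : fusion_system S :=
  FusionSystem FSG_id FSG_comp FSG_homS FSG_Inj FSG_fact.

End FusionOfGroup.

Canonical Op_upper_group (p : nat) (G : finGroupType) (A : {set G}) := Eval hnf in [group of Op_upper p A].

Section OpUpper.

Variables (p : nat) (G : finGroupType).
Implicit Types A B : {set G}.

Lemma Op_upper_sub (H : {group G}) : Op_upper p H \subset H.
Proof. by rewrite gen_subG; apply/subsetP=> x; rewrite inE => /andP[]. Qed.

Lemma transporterM A B D x y :
  x \in transporter A B -> y \in transporter B D -> y * x \in transporter A D.
Proof.
rewrite !inE invMg => sAB sBD; rewrite conjsgM.
by apply: subset_trans sBD; rewrite conjSg.
Qed.

Lemma transporterMC A B x c :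
  x \in transporter A B -> c \in 'C(A) -> x * c \in transporter A B.
Proof.
rewrite !(in_set (fun _ => _ \subset _)) => sAB cA; rewrite invMg conjsgM.
have nAc : c^-1 \in 'N(A) by rewrite groupV (subsetP (cent_sub A)).
by rewrite (normP nAc).
Qed.

Lemma Op_upper_transporter A B x : x \in transporter A B ->
  Op_upper p 'C(B) :^ x \subset Op_upper p 'C(A).
Proof.
rewrite inE sub_conjgV => sABx; rewrite -genJ genS //; apply/subsetP=> y.
rewrite mem_conjg !in_set p_eltJ => /andP[cy ->]; rewrite andbT.
by apply: (subsetP (centS sABx)); rewrite centJ mem_conjg.
Qed.

Lemma lcoset_comp A B x y : x \in transporter A B ->
  (y *: Op_upper p 'C(B)) * (x *: Op_upper p 'C(A)) = (y * x) *: Op_upper p 'C(A).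
Proof.
move=> Tx; have KJ : Op_upper p 'C(B) :* x = x *: (Op_upper p 'C(B) :^ x).
  by rewrite conjsgE -lcosetM mulgV mul1g.
rewrite -mulgA [_ * (x *: _)]mulgA KJ -[x *: _ * _]mulgA.
by rewrite mulSGid ?Op_upper_transporter // lcosetM.
Qed.

Lemma central_Sylow_Op (C Z : {group G}) : p.-Sylow(C) Z -> C \subset 'C(Z) ->
  Z * Op_upper p C = C /\ p^'.-group (Op_upper p C).
Proof.
move=> sylZ cZC; have sZC := pHall_sub sylZ.
have nZC : Z <| C by rewrite /normal sZC cents_norm.
have [K compK] : exists K : {group G}, K \in [complements to Z in C].
  by apply/splitsP; apply: SchurZassenhaus_split nZC; apply: pHall_Hall sylZ.
have hallK : p^'.-Hall(C) K by rewrite -(compl_pHall K sylZ).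
have [/complP[_ defC] sKC] := (compK, pHall_sub hallK).
have nKC : K <| C.
  rewrite /normal sKC -defC mulG_subG normG andbT.
  by rewrite cents_norm // centsC (subset_trans sKC).
suffices -> : Op_upper p C = K by rewrite defC (pHall_pgroup hallK).
apply/eqP; rewrite eqEsubset gen_subG; apply/andP; split; apply/subsetP=> x.
  by rewrite inE => /andP[Cx p'x]; rewrite (mem_normal_Hall hallK nKC).
move=> Kx; apply: mem_gen; rewrite inE (subsetP sKC) //=.
exact: mem_p_elt (pHall_pgroup hallK) Kx.
Qed.

End OpUpper.

Section LinkingOfGroup.

Variables (p : nat) (S G : finGroupType) (e : sylow_embedding p S G).
Variables (F : fusion_system S) (FG : fusion_eq F (FSG e)).
Local Notation i := (semb e).
Local Notation injI := (@semb_injective p S G e).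
Local Notation morI := (@sembM p S G e).
Local Notation memI := (@mem_semb p S G e).

Lemma cmapE (P Q : {group S}) x u : x \in transporter (i @* P) (i @* Q) ->
  i (sgval (cmap e P Q x u)) = i (sgval u) ^ x^-1.
Proof.
rewrite inE => /subsetP sPQ; have : i (sgval u) ^ x^-1 \in i @* Q.
  by apply: sPQ; rewrite memJ_conjg memI subgP.
case/morphimP=> v _ Qv def_v.
by rewrite ffunE def_v invmE ?inE // subgK.
Qed.

Lemma cmap_uniq (P Q : {group S}) x (phi : P ~> Q) :
    x \in transporter (i @* P) (i @* Q) ->
  (forall u, i (sgval (phi u)) = i (sgval u) ^ x^-1) -> phi = cmap e P Q x.
Proof.
by move=> Tx phiE; apply/ffunP=> u; apply/subg_inj/injI; rewrite phiE cmapE.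
Qed.

Lemma cmap_fhom (P Q : {group S}) x : x \in transporter (i @* P) (i @* Q) ->
  cmap e P Q x \in fhom F P Q.
Proof.
move=> Tx; rewrite FG inE; apply/existsP; exists x.
by apply/forallP=> u; rewrite cmapE.
Qed.

Lemma cmap_inj (P Q : {group S}) x y :
    x \in transporter (i @* P) (i @* Q) -> y \in transporter (i @* P) (i @* Q) ->
  cmap e P Q x = cmap e P Q y <-> x^-1 * y \in 'C(i @* P).
Proof.
move=> Tx Ty; split=> [exy | cxy].
  apply/centP=> _ /morphimP[u _ Pu ->]; apply/commute_sym/commgP/conjg_fixP.
  have := congr1 (fun f : P ~> Q => i (sgval (f (subg P u)))) exy.
  by rewrite !cmapE // subgK // => eJ; rewrite conjgM eJ -conjgM mulVg conjg1.
apply: cmap_uniq => // u; rewrite cmapE //.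
have fixu : i (sgval u) ^ (x^-1 * y) = i (sgval u).
  apply/conjg_fixP/commgP/commute_sym/(centP cxy).
  by rewrite memI subgP.
by rewrite -{2}fixu -conjgM mulgK.
Qed.

Lemma centric_Sylow (P : {group S}) : centric F P -> p.-Sylow('C(i @* P)) 'Z(i @* P).
Proof.
move=> cP; have pS := pHall_pgroup (semb_sylow e).
have pP : p.-group (i @* P) by apply: pgroupS pS; apply: morphimS; apply: subsetT.
have [T sylT] := Sylow_exists p 'C(i @* P).
have sTC := pHall_sub sylT; have pT := pHall_pgroup sylT.
have pPT : p.-group (i @* P <*> T) by rewrite /= cent_joinEr ?pgroupM ?pP.
have [x _ sPTx] := Sylow_subJ (semb_sylow e) (subsetT _) pPT.
move: sPTx; rewrite join_subG => /andP[sPx sTx].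
pose P' : {group S} := (i @*^-1 (i @* P :^ x^-1))%G.
have iP' : i @* P' = i @* P :^ x^-1 by rewrite morphpreK // sub_conjgV.
have Tx : x \in transporter (i @* P) (i @* P') by rewrite inE iP'.
have Tx' : x^-1 \in transporter (i @* P') (i @* P) by rewrite inE iP' invgK conjsgKV.
have conjP' : fconj F P P'.
  apply/set0Pn; exists (cmap e P P' x); rewrite inE cmap_fhom //=.
  apply/existsP; exists (cmap e P' P x^-1); rewrite cmap_fhom //=.
  apply/andP; split; apply/eqP/ffunP=> u; apply/subg_inj/injI.
    by rewrite fcompE !cmapE // invgK conjgKV ffunE.
  by rewrite fcompE !cmapE // invgK conjgK ffunE.
have /eqP cP' := implyP (forallP cP P') conjP'.
have sTP : T \subset i @* P.
  apply/subsetP=> t Tt; have Ctx : t ^ x^-1 \in 'C(i @* P').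
    by rewrite iP' centJ memJ_conjg (subsetP sTC).
  have : t ^ x^-1 \in i @* [set: S] by rewrite -mem_conjg (subsetP sTx).
  case/morphimP=> s _ _ def_s.
  have : s \in 'C(P').
    apply/centP=> v P'v; apply: injI; rewrite !morI -def_s.
    by apply: (centP Ctx); rewrite memI.
  rewrite cP' => /setIP[P's _].
  by rewrite -(memJ_conjg _ x^-1) -iP' def_s memI.
have sTZ : T \subset 'Z(i @* P) by rewrite subsetI sTP.
have pZ : p.-group 'Z(i @* P) := pgroupS (center_sub _) pP.
by rewrite (sub_pHall sylT pZ sTZ) ?subsetIr.
Qed.

Lemma centric_Op (P : {group S}) : centric F P ->
  'Z(i @* P) * Op_upper p 'C(i @* P) = 'C(i @* P) /\ p^'.-group (Op_upper p 'C(i @* P)).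
Proof.
move/centric_Sylow/central_Sylow_Op; apply.
by rewrite centsC; apply: subset_trans (center_sub _) _; rewrite -centsC.
Qed.

Local Notation im P := (i @* val P).
Local Notation K P := (Op_upper p 'C(im P)).

Definition LG_mor (P Q : cobj F) :=
  {C : {set G} | C \in [set x *: K P | x in transporter (im P) (im Q)]}.

Definition LG_class (P Q : cobj F) (x : G) (Tx : x \in transporter (im P) (im Q)) :
  LG_mor P Q := exist _ (x *: K P) (imset_f (fun y => y *: K P) Tx).

Lemma LG_morP (P Q : cobj F) (f : LG_mor P Q) :
  exists x (Tx : x \in transporter (im P) (im Q)), f = LG_class Tx.
Proof.
case: f => C def_C; have /imsetP[x Tx eC] := def_C.
by exists x, Tx; apply: val_inj.
Qed.

Lemma transporter1 (P : cobj F) : 1 \in transporter (im P) (im P).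
Proof. by rewrite inE invg1 conjsg1. Qed.

Lemma transporter_mem (P : cobj F) (u : subg_of (val P)) :
  i (sgval u) \in transporter (im P) (im P).
Proof. by rewrite inE conjGid // groupV memI subgP. Qed.

Definition LG_id (P : cobj F) : LG_mor P P := LG_class (transporter1 P).

Lemma LG_comp_subproof (P Q R : cobj F) (g : LG_mor Q R) (f : LG_mor P Q) :
  val g * val f \in [set x *: K P | x in transporter (im P) (im R)].
Proof.
have [y [Ty ->]] := LG_morP g; have [x [Tx ->]] := LG_morP f.
rewrite /= lcoset_comp //.
exact: (imset_f (fun z => z *: K P) (transporterM Tx Ty)).
Qed.

(* The class of y times the class of x is the class of yx (lcoset_comp), so that
   composition is the product of subsets of G. *)
Definition LG_comp (P Q R : cobj F) (g : LG_mor Q R) (f : LG_mor P Q) : LG_mor P R :=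
  exist _ (val g * val f) (LG_comp_subproof g f).

Lemma LG_compE (P Q R : cobj F) y x Ty Tx :
  LG_comp (@LG_class Q R y Ty) (@LG_class P Q x Tx) = LG_class (transporterM Tx Ty).
Proof. by apply: val_inj; rewrite /= lcoset_comp. Qed.

Definition LG_cat : category (cobj F).
Proof.
apply: (@Category _ LG_mor LG_id LG_comp).
- by move=> P Q R T h g f; apply: val_inj; rewrite /= mulgA.
- move=> P Q f; have [x [Tx ->]] := LG_morP f.
  by apply: val_inj; rewrite /= lcoset_comp // mul1g.
move=> P Q f; have [x [Tx ->]] := LG_morP f.
by apply: val_inj; rewrite /= lcoset_comp ?transporter1 // mulg1.
Defined.

Lemma repr_transporter (P Q : cobj F) (f : LG_mor P Q) :
  repr (val f) \in transporter (im P) (im Q).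
Proof.
have [x [Tx ->]] := LG_morP f.
have /lcosetP[k Kk def_r] : repr (x *: K P) \in x *: K P.
  exact: mem_repr (lcoset_refl [group of K P] x).
rewrite /= def_r.
exact: transporterMC Tx (subsetP (Op_upper_sub p 'C(im P)%G) k Kk).
Qed.

(* c_x for x in the class f, independently of x (see LG_piE). *)
Definition LG_pi_fun (P Q : cobj F) (f : LG_mor P Q) : mor (Fc F) P Q :=
  exist _ (cmap e (val P) (val Q) (repr (val f))) (cmap_fhom (repr_transporter f)).

Lemma LG_piE (P Q : cobj F) x (Tx : x \in transporter (im P) (im Q)) :
  val (LG_pi_fun (LG_class Tx)) = cmap e (val P) (val Q) x.
Proof.
apply/cmap_inj => //; first exact: (repr_transporter (LG_class Tx)).
have /lcosetP[k Kk def_r] : repr (x *: K P) \in x *: K P.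
  exact: mem_repr (lcoset_refl [group of K P] x).
rewrite /= def_r.
by rewrite invMg mulgKV groupV (subsetP (Op_upper_sub p 'C(im P)%G)).
Qed.

Definition LG_pi : functor LG_cat (Fc F).
Proof.
apply: (@Functor _ LG_cat (Fc F) LG_pi_fun) => [P | P Q R g f].
  apply: val_inj; rewrite LG_piE; apply/esym/cmap_uniq; first exact: transporter1.
  by move=> u; rewrite ffunE invg1 conjg1.
have [y [Ty ->]] := LG_morP g; have [x [Tx ->]] := LG_morP f.
apply: val_inj; rewrite [ccomp _ _]LG_compE LG_piE /= -/(val (LG_pi_fun _)).
rewrite -[cmap _ _ _ (repr (y *: _))]/(val (LG_pi_fun (LG_class Ty))).
rewrite -[cmap _ _ _ (repr (x *: _))]/(val (LG_pi_fun (LG_class Tx))) !LG_piE.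
apply/esym/cmap_uniq; first exact: transporterM Tx Ty.
by move=> u; rewrite fcompE !cmapE // invMg conjgM.
Defined.

Definition LG_delta (P : cobj F) (u : subg_of (val P)) : LG_mor P P :=
  LG_class (transporter_mem u).

Lemma LG_class_eq (P Q : cobj F) x y Tx Ty :
  @LG_class P Q x Tx = @LG_class P Q y Ty <-> x^-1 * y \in K P.
Proof.
rewrite -mem_lcoset; split=> [/(congr1 val) /= -> | xKy].
  exact: (lcoset_refl [group of K P]).
by apply: val_inj; apply/esym/(lcoset_eqP (G := [group of K P]))/xKy.
Qed.

Lemma Op_upper_semb1 (P : cobj F) u : i u \in K P -> u = 1.
Proof.
move=> Ku; apply: injI; rewrite morph1; apply/eqP; rewrite -order_eq1; apply/eqP.
have pS := pHall_pgroup (semb_sylow e); have [_ p'K] := centric_Op (valP P).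
apply: (@pnat_1 p); last exact: mem_p_elt p'K Ku.
by apply: mem_p_elt pS _; rewrite mem_morphim ?inE.
Qed.

(* L_S^c(G), as a centric linking system associated to F = F_S(G). *)
Definition LSG : linking_system F.
Proof.
apply: (@LinkingSystem _ F LG_cat LG_pi LG_delta).
- by move=> P; apply/LG_class_eq; rewrite morph1 mulg1 invg1 group1.
- move=> P x y; rewrite /= LG_compE; apply/LG_class_eq.
  by rewrite morI mulVg group1.
- move=> P x y /LG_class_eq; rewrite -morphV ?inE // -morI => /Op_upper_semb1 e1.
  by apply: subg_inj; apply/eqP; rewrite eq_mulVg1 e1.
- move=> P Q f z _; have [x [Tx ->]] := LG_morP f.
  rewrite /= LG_compE => /LG_class_eq; rewrite invMg mulgKV.
  by rewrite groupV => /Op_upper_semb1 z1; apply: subg_inj.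
- move=> P Q [phi Fphi]; have : phi \in hom_conj i (val P) (val Q) by have := FG (val P) (val Q) => /= <-.
  rewrite inE => /existsP[x /forallP phix].
  have Tx : x \in transporter (im P) (im Q).
    rewrite inE; apply/subsetP=> _ /imsetP[_ /morphimP[u _ Pu ->] ->].
    by have := phix (subg (val P) u); rewrite subgK // => /eqP <-; rewrite memI subgP.
  exists (LG_class Tx); apply: val_inj; rewrite LG_piE.
  by apply/esym/cmap_uniq => // u; apply/eqP.
- move=> P Q f g; have [x [Tx ->]] := LG_morP f; have [y [Ty ->]] := LG_morP g.
  split=> [/(congr1 val) | [z Zz ->]].
    rewrite !LG_piE => /cmap_inj => /(_ Tx Ty).
    have [<- _] := centric_Op (valP P); case/mulsgP=> z0 k /setIP[].
    case/morphimP=> z _ Pz -> Cz Kk exy; exists (subg (val P) z).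
      rewrite subgK // inE Pz; apply/centP=> v Pv; apply: injI; rewrite !morI.
      by apply: (centP Cz); rewrite memI.
    have def_y : y = x * i z * k by rewrite -mulgA -exy mulKVg.
    rewrite /= LG_compE; apply/esym/LG_class_eq.
    by rewrite subgK // def_y mulKg.
  rewrite /= LG_compE; apply: val_inj; rewrite !LG_piE.
  apply/cmap_inj => //; first exact: transporterM (transporter_mem z) Tx.
  rewrite mulKg; case/setIP: Zz => Pz Cz; apply/centP=> _ /morphimP[v _ Pv ->].
  by rewrite /commute -!morI (centP Cz).
- move=> P x u; rewrite LG_piE; apply/subg_inj/injI; rewrite cmapE ?transporter_mem //.
  by rewrite morphJ ?inE // morphV ?inE.
move=> P Q f x; have [y [Ty def_f]] := LG_morP f.
have phiE : i (sgval (val (fmap LG_pi f) x)) = i (sgval x) ^ y^-1.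
  by rewrite def_f LG_piE cmapE.
rewrite def_f in phiE *; rewrite /= !LG_compE; apply/LG_class_eq.
by rewrite phiE conjgE invgK invMg !mulgA mulgKV mulgKV mulVg group1.
Defined.

End LinkingOfGroup.

(* Main.v *)
Require Import Defs.
From mathcomp Require Import all_boot all_fingroup all_solvable.
From mathcomp Require Import ssralg boolp.

(* Fix Q normal and centric in F, and let conjugation act on the right. A saturated
   fusion system determines an F-morphism defined on P >= Q by its restriction to Q,
   up to conjugation by Z(Q). A "torsor" is a set X over Aut_F(Q), with fibres
   permuted regularly by Z(Q) and with commuting left and right actions of S, such
   that the isomorphisms between subgroups of S induced by the points of X are in F;
   both a model G and Aut_L(Q) are torsors. By the uniqueness of extensions, two
   torsors are isomorphic as bisets, even after twisting one right action by an
   F-morphism.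
   - Existence: in Sym(S), with S acting regularly, every morphism of F is a
     conjugation, which gives a torsor X. Let E be the group of the left
     S-equivariant permutations of X lying over right translations of Aut_F(Q). The
     kernel of E -> Aut_F(Q) consists of the Z(Q)-valued functions on S\X; dividing E
     by the functions with product 1 gives an extension G of Aut_F(Q) by Z(Q), and
     S still embeds in it because |S\X| = |Aut_F(Q) : Aut_S(Q)| is prime to p.
   - Uniqueness: a biset isomorphism f from G to Aut_L(Q) is multiplicative up to a
     factor zeta(x, g) in Z(Q), constant for x in a left S-orbit; correcting f g by
     the average of zeta(-, g) over S\G gives a group isomorphism.
   - Linking systems: morphisms P -> R of L extend to PQ -> RQ and restrict to Q -> Q,
     and so come from Aut_L(Q) = G. *)

Set Implicit Arguments.
Unset Strict Implicit.
Unset Printing Implicit Defensive.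

Local Open Scope group_scope.

(** * Fusion systems in terms of maps S -> S *)

Section Restrictions.

Variables (S : finGroupType) (F : fusion_system S).
Implicit Types (P Q R : {group S}) (f g : S -> S).

(* A morphism P -> S of F is handled as a map S -> S of which only the values
   on P matter. *)
Definition inF P f : bool :=
  [ffun u : subg_of P => subg [set: S]%G (f (sgval u))] \in fhom F P [set: S]%G.

Lemma inF_eq P f g : {in P, f =1 g} -> inF P f -> inF P g.
Proof.
rewrite /inF => efg; set phi := finfun _ => Fphi.
suffices <- : phi = [ffun u : subg_of P => subg [set: S]%G (g (sgval u))] by [].
by apply/ffunP=> u; rewrite !ffunE efg ?subgP.
Qed.

Lemma fincl_homS P R : P \subset R -> fincl P R \in homS P R.
Proof.
move=> sPR; rewrite inE; apply/existsP; exists 1; apply/forallP=> u.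
by rewrite ffunE invg1 conjg1 subgK // (subsetP sPR) ?subgP.
Qed.

(** The codomain can be changed thanks to the factorization axiom: [f] is an isomorphism onto some
    [T] followed by an inclusion, [T] lies in [R] because [phi] has the same values, and the
    inclusion of [T] in [R] is in [F]. *)
Lemma inF_fhom P R f (phi : P ~> R) :
  inF P f -> (forall u, sgval (phi u) = f (sgval u)) -> phi \in fhom F P R.
Proof.
move=> Ff phiE; have [T [psi [isopsi _ def_f]]] := fhom_fact Ff.
have fE u : f (sgval u) = sgval (psi u).
  have := congr1 (fun h : P ~> [set: S] => sgval (h u)) def_f.
  by rewrite !ffunE !subgK ?inE.
move: isopsi; rewrite inE => /andP[Fpsi /existsP[chi /and3P[_ _ /eqP Kpsi]]].
have sTR : T \subset R.
  apply/subsetP=> t Tt; have <- : sgval (psi (chi (subg T t))) = t.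
    by rewrite -fcompE Kpsi ffunE subgK.
  by rewrite -fE -phiE subgP.
suffices -> : phi = fcomp (fincl T R) psi.
  by apply: fhom_comp Fpsi; apply: (subsetP (fhom_homS F T R)) (fincl_homS sTR).
apply/ffunP=> u; apply: subg_inj.
by rewrite phiE fE !ffunE subgK // (subsetP sTR) ?subgP.
Qed.

Lemma fhom_inF P R (phi : P ~> R) :
  phi \in fhom F P R -> inF P (fun x => sgval (phi (subg P x))).
Proof.
move=> Fphi; rewrite /inF.
suffices -> : [ffun u => subg [set: S]%G (sgval (phi (subg P (sgval u))))]
  = fcomp (fincl R [set: S]%G) phi.
  apply: fhom_comp Fphi; apply: (subsetP (fhom_homS F R [set: S]%G)).
  exact: fincl_homS (subsetT R).
by apply/ffunP=> u; rewrite !ffunE sgvalK.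
Qed.

Lemma inF_inj P f : inF P f -> {in P &, injective f}.
Proof.
move=> Ff; have /InjP[injf _] := subsetP (fhom_Inj F P _) _ Ff.
move=> x y Px Py efxy; have : subg P x = subg P y.
  by apply: injf; rewrite !ffunE !subgK // efxy.
by move/(congr1 (@sgval _ P)); rewrite !subgK.
Qed.

Lemma inF_M P f : inF P f -> {in P &, {morph f : x y / x * y}}.
Proof.
move=> Ff; have /InjP[_ fM] := subsetP (fhom_Inj F P _) _ Ff.
move=> x y Px Py; have := congr1 val (fM (subg P x) (subg P y)).
by rewrite !ffunE /= !subgK ?groupM ?inE.
Qed.

Lemma inF_1 P f : inF P f -> f 1 = 1.
Proof. by move=> Ff; apply: (mulgI (f 1)); rewrite -(inF_M Ff) ?mulg1. Qed.

Lemma inF_V P f : inF P f -> {in P, {morph f : x / x^-1}}.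
Proof.
move=> Ff x Px; apply: (mulgI (f x)).
by rewrite -(inF_M Ff) ?groupV // !mulgV (inF_1 Ff).
Qed.

Lemma inF_J P f : inF P f -> {in P &, {morph f : x y / x ^ y}}.
Proof.
move=> Ff x y Px Py; rewrite !conjgE.
by rewrite !(inF_M Ff) ?groupM ?groupV // (inF_V Ff).
Qed.

Lemma inF_group_set P f : inF P f -> group_set (f @: P).
Proof.
move=> Ff; apply/group_setP; split.
  by apply/imsetP; exists 1; rewrite ?(inF_1 Ff).
move=> _ _ /imsetP[x Px ->] /imsetP[y Py ->].
by rewrite -(inF_M Ff) // imset_f ?groupM.
Qed.

Lemma inF_sub P R f : R \subset P -> inF P f -> inF R f.
Proof.
move=> sRP Ff; rewrite {1}/inF.
suffices -> : [ffun u : subg_of R => subg [set: S]%G (f (sgval u))] =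
  fcomp [ffun u : subg_of P => subg [set: S]%G (f (sgval u))] (fincl R P).
  apply: fhom_comp Ff _; apply: (subsetP (fhom_homS F R P)).
  exact: fincl_homS.
by apply/ffunP=> u; rewrite !ffunE subgK // (subsetP sRP) ?subgP.
Qed.

Lemma inF_comp P R f g :
  inF P f -> inF R g -> {in P, forall x, f x \in R} -> inF P (g \o f).
Proof.
move=> Ff Fg fPR; pose phi : P ~> R := [ffun u => subg R (f (sgval u))].
have Fphi : phi \in fhom F P R.
  by apply: (inF_fhom Ff) => u; rewrite ffunE subgK ?fPR ?subgP.
rewrite {1}/inF; suffices -> : [ffun u : subg_of P => subg [set: S]%G ((g \o f) (sgval u))] =
  fcomp [ffun u : subg_of R => subg [set: S]%G (g (sgval u))] phi.
  exact: fhom_comp Fg Fphi.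
by apply/ffunP=> u; rewrite !ffunE /= subgK ?fPR ?subgP.
Qed.

Lemma inF_conj P s : inF P (fun x => x ^ s).
Proof.
apply: (subsetP (fhom_homS F P _)); rewrite inE; apply/existsP; exists s^-1.
by apply/forallP=> u; rewrite ffunE subgK ?inE // invgK.
Qed.

Lemma inF_id P : inF P id.
Proof. by apply: inF_eq (inF_conj P 1) => x _; rewrite conjg1. Qed.

Lemma inF_isos P R f : inF P f -> f @: P = R ->
  [ffun u : subg_of P => subg R (f (sgval u))] \in isos_in (fhom F) P R.
Proof.
move=> Ff defR; have [T [psi [isopsi _ def_f]]] := fhom_fact Ff.
have fE u : f (sgval u) = sgval (psi u).
  have := congr1 (fun h : P ~> [set: S] => sgval (h u)) def_f.
  by rewrite !ffunE !subgK ?inE.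
have [_ /existsP[chi /and3P[_ _ /eqP Kpsi]]] := setIdP isopsi.
have eTR : T = R.
  apply/val_inj; rewrite /= -defR; apply/setP=> t; apply/idP/imsetP=> [Tt|[x Px ->]].
    exists (sgval (chi (subg T t))); first exact: subgP.
    by rewrite fE -fcompE Kpsi ffunE subgK.
  by have := fE (subg P x); rewrite subgK // => ->; apply: subgP.
subst T; suffices <- : psi = [ffun u : subg_of P => subg R (f (sgval u))] by [].
by apply/ffunP=> u; apply: subg_inj; rewrite ffunE fE sgvalK.
Qed.

Lemma inF_fconj P R f : inF P f -> f @: P = R -> fconj F P R.
Proof. by move=> Ff defR; apply/set0Pn; eexists; apply: inF_isos Ff defR. Qed.

(** The domain of the inverse ranges over groups [R] inside [f @: P], since this image is only a set
    while [inF] takes a group. *)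
Lemma inF_inv P f : inF P f ->
  exists2 g, (forall R : {group S}, R \subset f @: P -> inF R g)
           & {in P, cancel f g}.
Proof.
move=> Ff; pose R := Group (inF_group_set Ff).
have := inF_isos (R := R) Ff erefl; rewrite inE => /andP[_ /existsP[chi]].
case/and3P=> Fchi /eqP Kchi _; exists (fun x => sgval (chi (subg R x))).
  by move=> R' sR'; apply: inF_sub (fhom_inF Fchi).
move=> x Px; have := congr1 (fun h : P ~> P => sgval (h (subg P x))) Kchi.
by rewrite !ffunE subgK.
Qed.

Lemma fconjP P R : fconj F P R -> exists2 f, inF P f & f @: P = R.
Proof.
case/set0Pn=> phi; rewrite inE => /andP[Fphi /existsP[psi /and3P[_ _ /eqP Kphi]]].
exists (fun x => sgval (phi (subg P x))); first exact: fhom_inF.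
apply/setP=> y; apply/imsetP/idP=> [[x Px ->]|Ry]; first exact: subgP.
exists (sgval (psi (subg R y))); first exact: subgP.
by rewrite sgvalK -fcompE Kphi ffunE subgK.
Qed.

Lemma fconj_trans P R T : fconj F P R -> fconj F R T -> fconj F P T.
Proof.
move=> /fconjP[f Ff defR] /fconjP[g Fg defT]; apply: (@inF_fconj _ _ (g \o f)).
  by apply: inF_comp Ff Fg _ => x Px; rewrite -defR imset_f.
by rewrite imset_comp defR.
Qed.

Lemma fconj_refl P : fconj F P P.
Proof. by apply: (inF_fconj (inF_id P)); rewrite imset_id. Qed.

Lemma fully_normalized_conj P : exists2 R, fconj F P R & fully_normalized F R.
Proof.
have [R cPR maxR] := arg_maxnP (fun R : {group S} => #|'N(R)|) (fconj_refl P).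
exists R => //; apply/forallP=> T; apply/implyP=> cRT.
exact: maxR (fconj_trans cPR cRT).
Qed.

End Restrictions.

(** * Automorphisms of a subgroup as maps S -> S *)

Section Automorphisms.

Variables (S : finGroupType) (P : {group S}).

(** Permutations multiply from left to right, so this is a right action ([apM]), like conjugation on
    the right. An argument outside [P] is replaced by 1. *)
Definition ap (a : {perm subg_of P}) (x : S) : S := sgval (a (subg P x)).

Lemma ap_mem a x : ap a x \in P.
Proof. exact: subgP. Qed.

Lemma ap_sgval a u : ap a (sgval u) = sgval (a u).
Proof. by rewrite /ap sgvalK. Qed.

Lemma ap_eq a b : {in P, ap a =1 ap b} -> a = b.
Proof.
by move=> eab; apply/permP=> u; apply: subg_inj; rewrite -!ap_sgval eab ?subgP.
Qed.

Lemma apM a b x : ap (a * b) x = ap b (ap a x).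
Proof. by rewrite /ap permM sgvalK. Qed.

Lemma ap1 : {in P, ap 1 =1 id}.
Proof. by move=> x Px; rewrite /ap perm1 subgK. Qed.

Lemma apK a : {in P, cancel (ap a) (ap a^-1)}.
Proof. by move=> x Px; rewrite -apM mulgV ap1. Qed.

Lemma apKV a : {in P, cancel (ap a^-1) (ap a)}.
Proof. by move=> x Px; rewrite -apM mulVg ap1. Qed.

Variable F : fusion_system S.

Lemma AutF_inF a : a \in AutF F P -> inF F P (ap a).
Proof.
rewrite inE => /fhom_inF; apply: inF_eq => x Px.
by rewrite ffunE.
Qed.

Lemma inF_AutF f : inF F P f -> {in P, forall x, f x \in P} ->
  exists2 a, a \in AutF F P & {in P, ap a =1 f}.
Proof.
move=> Ff fP; pose h (u : subg_of P) := subg P (f (sgval u)).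
have injh : injective h.
  move=> u v /(congr1 (@sgval _ P)); rewrite !subgK ?fP ?subgP //.
  by move/(inF_inj Ff (subgP u) (subgP v))/subg_inj.
exists (perm injh) => [|x Px]; last by rewrite /ap permE /h !subgK ?fP.
rewrite inE; apply: (inF_fhom Ff) => u.
by rewrite ffunE permE subgK ?fP ?subgP.
Qed.

End Automorphisms.

(** * Rigidity of morphisms over a normal centric subgroup *)

Section NormalCentric.

Variables (p : nat) (S : finGroupType) (F : fusion_system S) (Q : {group S}).
Hypotheses (pS : p.-group [set: S]) (satF : saturated F p).
Hypotheses (cQ : centric F Q) (nQ : fnormal F Q).
Implicit Types (P R : {group S}) (f g : S -> S).

Local Notation Z := 'Z(Q).

Lemma norm_fnormal s : s \in 'N(Q).
Proof. by apply: (subsetP (normal_norm nQ.1)); rewrite inE. Qed.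

Lemma cent_centric : 'C(Q) = Z.
Proof. by have /forallP/(_ Q)/implyP/(_ (fconj_refl F Q))/eqP := cQ. Qed.

Lemma inF_extend P f : inF F P f ->
  exists g, [/\ inF F (P <*> Q)%G g, {in P, g =1 f} & {in Q, forall u, g u \in Q}].
Proof.
move=> Ff; have [abar [Fa ea Qa]] := nQ.2 _ _ _ Ff.
exists (fun x => sgval (abar (subg (P <*> Q)%G x))); split; first exact: fhom_inF.
  by move=> x Px; rewrite ea // !ffunE !subgK ?inE.
move=> u Qu; have: sgval (abar (subg (P <*> Q)%G u)) \in fimset abar Q.
  apply: imset_f; rewrite inE subgK //.
  exact: (subsetP (joing_subr P Q)).
by rewrite Qa.
Qed.

Lemma inF_mem_fnormal P f : inF F P f -> Q \subset P -> {in Q, forall u, f u \in Q}.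
Proof.
move=> Ff sQP u Qu; have [g [_ eg Qg]] := inF_extend Ff.
by rewrite -eg ?Qg ?(subsetP sQP).
Qed.

Lemma inF_imset_fnormal P f : inF F P f -> Q \subset P -> f @: Q = Q.
Proof.
move=> Ff sQP; apply/eqP; rewrite eqEcard card_in_imset ?leqnn ?andbT.
  by apply/subsetP=> _ /imsetP[u Qu ->]; apply: inF_mem_fnormal Ff sQP u Qu.
exact: (inF_inj (inF_sub sQP Ff)).
Qed.

Lemma inF_restrict P f : inF F P f -> Q \subset P ->
  exists2 a, a \in AutF F Q & {in Q, ap a =1 f}.
Proof.
move=> Ff sQP; apply: inF_AutF; first exact: inF_sub sQP Ff.
exact: inF_mem_fnormal Ff sQP.
Qed.

(** Every morphism on [Q] has image [Q], so [Q] is alone in its conjugacy class. *)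
Lemma fully_centralized_fnormal P : fconj F Q P -> fully_centralized F P.
Proof.
case/fconjP=> f Ff; rewrite (inF_imset_fnormal Ff (subxx Q)) => /val_inj <- {f Ff P}.
apply/forallP=> P; apply/implyP=> /fconjP[f Ff].
by rewrite (inF_imset_fnormal Ff (subxx Q)) => /val_inj <-.
Qed.

Lemma fully_normalized_fnormal : fully_normalized F Q.
Proof.
apply/forallP=> P; apply/implyP=> /fconjP[f Ff].
by rewrite (inF_imset_fnormal Ff (subxx Q)) => /val_inj <-.
Qed.

Lemma Sylow_AutS : p.-Sylow(AutF F Q) (AutS Q).
Proof. by case: (satF Q) => /(_ fully_normalized_fnormal)[]. Qed.

(** A conjugate [R] of [P] again contains [Q], whence C(R) <= C(Q) = Z(Q) <= R. *)
Lemma centric_overgroup P : Q \subset P -> centric F P.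
Proof.
move=> sQP; apply/forallP=> R; apply/implyP=> /fconjP[f Ff defR].
have sQR : Q \subset R by rewrite -defR -(inF_imset_fnormal Ff sQP) imsetS.
rewrite /center (setIidPr _) //; apply: subset_trans (centS sQR) _.
by rewrite cent_centric subIset // sQR.
Qed.

(** As [f] fixes [Q] pointwise, [x] and [f x] conjugate [Q] in the same way; their quotient lies in
    C(Q) = Z(Q). *)
Lemma inF_coset P f : inF F P f -> Q \subset P -> {in Q, f =1 id} ->
  {in P, forall x, x^-1 * f x \in Z}.
Proof.
move=> Ff sQP f1 x Px; rewrite -cent_centric; apply/centP=> u Qu.
have Nx := norm_fnormal x; have Qux : u ^ x^-1 \in Q by rewrite memJ_norm ?groupV.
apply/commute_sym/commgP/conjg_fixP; rewrite conjgM -(f1 _ Qux).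
by rewrite -(inF_J Ff (subsetP sQP _ Qux) Px) conjgKV f1.
Qed.

(** The automorphisms of [R] trivial on [Q] form a normal subgroup [K] of Aut_F(R). Each [b] in [K]
    moves [x] by an element of Z(Q), itself fixed by [b], so [b ^+ #|Z| = 1] and [K] is a p-group.
    Hence [K] lies in the Sylow subgroup Aut_S(R), and an element of [S] inducing [a] centralizes
    [Q]. *)
Lemma AutF_id_fnormal R a : fully_normalized F R -> Q \subset R -> a \in AutF F R ->
  {in Q, ap a =1 id} -> exists2 z, z \in Z & {in R, forall x, ap a x = x ^ z}.
Proof.
move=> nR sQR Fa a1; have [/(_ nR)[_ sylR] _] := satF R.
pose U := [set u : subg_of R | sgval u \in Q].
pose K := 'C_(AutF F R)(U | 'P)%G.
have inK b : b \in K -> b \in AutF F R /\ {in Q, ap b =1 id}.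
  case/setIP=> Fb /astabP fixb; split=> // u Qu.
  rewrite /ap -[b _]/('P%act _ b) fixb ?subgK ?(subsetP sQR) //.
  by rewrite inE subgK // (subsetP sQR).
have pK : p.-group K.
  apply/pgroupP=> q q_pr /(Cauchy q_pr)[b Kb ob].
  have [Fb b1] := inK b Kb; have FFb := AutF_inF Fb.
  have bn n x : x \in R -> ap (b ^+ n) x = x * (x^-1 * ap b x) ^+ n.
    move=> Rx; elim: n => [|n IHn]; first by rewrite expg0 ap1 ?mulg1.
    have Zx := inF_coset FFb sQR b1 Rx.
    have Qz : (x^-1 * ap b x) ^+ n \in Q by rewrite groupX // (subsetP (center_sub _) _ Zx).
    rewrite expgSr apM IHn (inF_M FFb) ?(subsetP sQR _ Qz) // (b1 _ Qz).
    by rewrite expgS mulgA mulKVg.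
  have : b ^+ #|Z| = 1.
    apply: ap_eq => x Rx; rewrite bn // ap1 //.
    by rewrite (expg_cardG (inF_coset FFb sQR b1 Rx)) mulg1.
  move/eqP; rewrite -order_dvdn ob => q_dv.
  by rewrite (pgroupP (pgroupS (subsetT Z) pS)).
have nKR : K <| AutF F R.
  rewrite /normal subsetIl; apply/subsetP=> b Fb; rewrite inE.
  apply/subsetP=> _ /imsetP[c Kc ->]; have [Fc c1] := inK c Kc.
  rewrite inE groupJ //; apply/astabP=> u; rewrite inE => Qu.
  apply: subg_inj; rewrite -[LHS]ap_sgval conjgE !apM c1.
    by rewrite apKV ?subgP.
  by rewrite (inF_mem_fnormal (AutF_inF (groupVr Fb))).
have Ka : a \in K.
  rewrite inE Fa; apply/astabP=> u; rewrite inE => Qu.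
  by apply: subg_inj; rewrite -[LHS]ap_sgval a1.
have : a \in AutS R by apply: (subsetP (normal_sub_max_pgroup (Hall_max sylR) pK nKR)).
rewrite !inE => /existsP[z /forallP az]; have {}az x : x \in R -> ap a x = x ^ z^-1.
  by move=> Rx; have /eqP := az (subg R x); rewrite ffunE -ap_sgval subgK.
exists z^-1 => //; rewrite -cent_centric; apply/centP=> u Qu.
by apply/commute_sym/commgP/conjg_fixP; rewrite -az ?(subsetP sQR) // a1.
Qed.

(** Since [f] moves points by elements of Z(Q) <= P, it is an automorphism of [P]. Conjugating it by
    an isomorphism [h] onto a fully normalized [R] reduces to [AutF_id_fnormal]. *)
Lemma inF_id_fnormal P f : inF F P f -> Q \subset P -> {in Q, f =1 id} ->
  exists2 z, z \in Z & {in P, forall x, f x = x ^ z}.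
Proof.
move=> Ff sQP f1; have sZP := subset_trans (center_sub Q) sQP.
have fP x : x \in P -> f x \in P.
  by move=> Px; rewrite -(groupMl _ (groupVr Px)) (subsetP sZP) ?(inF_coset Ff).
have [R cPR nR] := fully_normalized_conj F P.
have [h Fh defR] := fconjP cPR; have [k Fk hK] := inF_inv Fh.
have {}Fk : inF F R k by apply: Fk; rewrite defR.
have sQR : Q \subset R by rewrite -defR -(inF_imset_fnormal Fh sQP) imsetS.
have kP x : x \in R -> k x \in P.
  by rewrite -defR => /imsetP[y Py ->]; rewrite hK.
have kK : {in R, cancel k h}.
  by move=> x; rewrite -defR => /imsetP[y Py ->]; rewrite hK.
have hR x : x \in P -> h x \in R by move=> Px; rewrite -defR imset_f.
have FRR : inF F R (h \o (f \o k)).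
  apply: (@inF_comp _ _ _ P) Fh _; last by move=> x Rx; rewrite /= fP ?kP.
  by apply: inF_comp Fk Ff _.
have [|a Fa ea] := inF_AutF FRR; first by move=> x Rx; rewrite /= hR ?fP ?kP.
have kQ := inF_mem_fnormal Fk sQR.
have [|z Zz az] := AutF_id_fnormal nR sQR Fa.
  by move=> u Qu; rewrite ea ?(subsetP sQR) //= f1 ?kQ ?kK ?(subsetP sQR).
have Rz : z \in R by rewrite (subsetP sQR) // (subsetP (center_sub Q)).
have fE x : x \in P -> f x = x ^ k z.
  move=> Px; rewrite -[LHS]hK ?fP //; have := az (h x) (hR x Px).
  by rewrite ea ?hR //= hK // => ->; rewrite (inF_J Fk) ?hR ?hK.
exists (k z) => //; rewrite -cent_centric; apply/centP=> u Qu.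
by apply/commute_sym/commgP/conjg_fixP; rewrite -fE ?(subsetP sQP) // f1.
Qed.

(** The uniqueness of extensions from [Q]: the previous lemma is applied to g f^-1 on f(P). *)
Lemma inF_eq_fnormal P f g : inF F P f -> inF F P g -> Q \subset P ->
  {in Q, f =1 g} -> exists2 z, z \in Z & {in P, forall x, g x = f x ^ z}.
Proof.
move=> Ff Fg sQP efg; have [k Fk fK] := inF_inv Ff.
have {}Fk := Fk (Group (inF_group_set Ff)) (subxx _).
have sQR : Q \subset Group (inF_group_set Ff).
  by rewrite /= -{1}(inF_imset_fnormal Ff sQP) imsetS.
have [||z Zz ez] := @inF_id_fnormal (Group (inF_group_set Ff)) (g \o k) _ sQR.
- by apply: inF_comp Fk Fg _ => _ /imsetP[x Px ->]; rewrite fK.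
- move=> u; rewrite -{1}(inF_imset_fnormal Ff sQP) => /imsetP[v Qv ->] /=.
  by rewrite fK ?(subsetP sQP) // efg.
exists z => // x Px; rewrite -ez /=; first by rewrite fK.
exact: imset_f.
Qed.

End NormalCentric.

(** By extensionality equivalent points have equal predicates [R x], so a choice made from the
    predicate gives them the same representative. *)
Lemma choose_representatives (X : Type) (R : X -> X -> Prop) :
  (forall x, R x x) -> (forall x y, R x y -> R y x) ->
  (forall x y z, R x y -> R y z -> R x z) ->
  exists2 rep : X -> X, forall x, R x (rep x) & forall x y, R x y -> rep x = rep y.
Proof.
move=> Rxx Rsym Rtr; case: (pselect (inhabited X)) => [[x0] | noX]; last first.
  by exists id => x; case: noX.
have [|c cP] := @choice (X -> Prop) X (fun A x => (exists y, A y) -> A x).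
  move=> A; case: (pselect (exists x, A x)) => [[x Ax] | noA].
    by exists x.
  by exists x0 => /noA.
exists (fun x => c (R x)) => [x | x y Rxy]; first by apply: cP; exists x.
suffices -> : R x = R y by [].
apply: funext => z; apply: propext; split; last exact: Rtr.
exact: Rtr (Rsym _ _ Rxy).
Qed.

(** * Torsors and biset maps *)

Section ConjugationAction.

Variables (S : finGroupType) (Q : {group S}).

(* The conditional makes the map injective for all s; only s \in 'N(Q) matters. *)
Definition conj_subg (s : S) (u : subg_of Q) : subg_of Q :=
  subg Q (sgval u ^ (if s \in 'N(Q) then s else 1)).

Lemma conj_subg_inj s : injective (conj_subg s).
Proof.
have cQ (u : subg_of Q) : sgval u ^ (if s \in 'N(Q) then s else 1) \in Q.
  by case: ifP => [Ns|_]; rewrite ?conjg1 ?memJ_norm ?subgP.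
move=> u v /(congr1 (@sgval _ Q)); rewrite !subgK ?cQ //.
by move/conjg_inj/subg_inj.
Qed.

Definition cperm s : {perm subg_of Q} := perm (@conj_subg_inj s).

Lemma ap_cperm s u : s \in 'N(Q) -> u \in Q -> ap (cperm s) u = u ^ s.
Proof. by move=> Ns Qu; rewrite /ap permE /conj_subg Ns !subgK ?memJ_norm. Qed.

Lemma cpermM : {in 'N(Q) &, {morph cperm : s t / s * t}}.
Proof.
move=> s t Ns Nt; apply: ap_eq => u Qu.
by rewrite apM !ap_cperm ?memJ_norm ?(groupM Ns Nt) // conjgM.
Qed.

Lemma cperm_eq1 s : s \in 'N(Q) -> (cperm s == 1) = (s \in 'C(Q)).
Proof.
move=> Ns; apply/eqP/centP => [s1 u Qu | cs].
  apply/commute_sym/commgP/conjg_fixP.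
  by rewrite -ap_cperm // s1 ap1.
apply: ap_eq => u Qu; rewrite ap_cperm // ap1 //.
by apply/conjg_fixP/commgP/commute_sym/cs.
Qed.

Lemma mem_AutS s : s \in 'N(Q) -> cperm s \in AutS Q.
Proof.
move=> Ns; rewrite !inE; apply/existsP; exists s^-1; apply/forallP=> u.
by rewrite invgK ffunE -ap_sgval ap_cperm ?subgP.
Qed.

Lemma AutSP a : 'N(Q) = [set: S] -> a \in AutS Q -> exists s, a = cperm s.
Proof.
move=> NQ; rewrite !inE => /existsP[s /forallP as_]; exists s^-1.
apply: ap_eq => u Qu; rewrite ap_cperm ?NQ ?inE //.
by have /eqP := as_ (subg Q u); rewrite ffunE subgK.
Qed.

End ConjugationAction.

(* A model G of F, with S <= G acting on both sides, stripped of its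
   multiplication: tp x stands for conjugation by x on Q, and tp_inj, tr_free for
   C_G(Q) = Z(Q). Conjugation is on the right. *)
Record torsor (S : finGroupType) (F : fusion_system S) (Q : {group S}) (X : Type) :=
  Torsor {
  tl : S -> X -> X;
  tr : X -> S -> X;
  tp : X -> {perm subg_of Q};
  tl1 : forall x, tl 1 x = x;
  tlM : forall s t x, tl (s * t) x = tl s (tl t x);
  tr1 : forall x, tr x 1 = x;
  trM : forall x s t, tr x (s * t) = tr (tr x s) t;
  tlr : forall s x t, tl s (tr x t) = tr (tl s x) t;
  tp_Aut : forall x, tp x \in AutF F Q;
  tp_l : forall s x, tp (tl s x) = cperm Q s * tp x;
  tp_r : forall x s, tp (tr x s) = tp x * cperm Q s;
  tp_surj : forall a, a \in AutF F Q -> exists x, tp x = a;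
  tp_inj : forall x y, tp x = tp y -> exists2 z, z \in 'Z(Q) & y = tr x z;
  tr_free : forall x z, z \in 'Z(Q) -> tr x z = x -> z = 1;
  tl_Q : forall x u, u \in Q -> tl u x = tr x (ap (tp x) u);
  t_inF : forall x (P : {group S}) (psi : S -> S), Q \subset P ->
    (forall s, s \in P -> tl s x = tr x (psi s)) -> inF F P psi
}.

Section Torsors.

Variables (p : nat) (S : finGroupType) (F : fusion_system S) (Q : {group S}).
Hypotheses (pS : p.-group [set: S]) (satF : saturated F p).
Hypotheses (cQ : centric F Q) (nQ : fnormal F Q).
Implicit Types (P R : {group S}) (f g : S -> S).

Local Notation Z := 'Z(Q).
Local Notation cS := (cperm Q).
Local Notation inNQ := (norm_fnormal nQ).

Lemma cSM s t : cS (s * t) = cS s * cS t.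
Proof. by rewrite cpermM ?inNQ. Qed.

Lemma cS1 : cS 1 = 1.
Proof. by apply/eqP; rewrite cperm_eq1 ?group1. Qed.

Lemma cSV s : cS s^-1 = (cS s)^-1.
Proof. by apply: (mulgI (cS s)); rewrite -cSM !mulgV cS1. Qed.

Lemma cS_eq1 s : (cS s == 1) = (s \in Z).
Proof. by rewrite cperm_eq1 ?inNQ // (cent_centric cQ). Qed.

Lemma cS_eq s t : cS s = cS t -> exists2 z, z \in Z & t = s * z.
Proof.
move=> est; exists (s^-1 * t); last by rewrite mulKVg.
by rewrite -cS_eq1 cSM cSV est mulVg.
Qed.

(** This is f(u^s) = f(u)^f(s), read as an identity between permutations of [Q]. *)
Lemma cS_inF P f a s : inF F P f -> Q \subset P -> {in Q, ap a =1 f} ->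
  s \in P -> cS s * a = a * cS (f s).
Proof.
move=> Ff sQP ea Ps; apply: ap_eq => u Qu; rewrite !apM !ap_cperm ?inNQ ?ap_mem //.
by rewrite !ea ?memJ_norm ?inNQ // (inF_J Ff (subsetP sQP _ Qu) Ps).
Qed.

Lemma fnormal_center P f : inF F P f -> Q \subset P -> {in Z, forall z, f z \in Z}.
Proof.
move=> Ff sQP z Zz; have [a Fa ea] := inF_restrict nQ Ff sQP.
have sZP := subset_trans (center_sub Q) sQP.
rewrite -cS_eq1 -(inj_eq (mulgI a)) mulg1.
rewrite -(cS_inF Ff sQP ea) ?(subsetP sZP) //.
by have /eqP-> : cS z == 1; rewrite ?mul1g // cS_eq1.
Qed.

Section OneTorsor.

Variables (X : Type) (T : torsor F Q X).
Local Notation l := (tl T).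
Local Notation r := (tr T).
Local Notation pr := (tp T).

(** Freeness passes from Z(Q) to all of [S]: an element fixing [x] on the right acts trivially on
    [Q], hence lies in Z(Q). *)
Lemma tr_inj x s t : r x s = r x t -> s = t.
Proof.
move=> est; have e1 : r x (s * t^-1) = x by rewrite trM est -trM mulgV tr1.
apply/eqP; rewrite eq_mulgV1; apply/eqP/(tr_free (x := x) (t0 := T)) => //.
by rewrite -cS_eq1 -(inj_eq (mulgI (pr x))) -tp_r e1 mulg1.
Qed.

Lemma trK x s : r (r x s) s^-1 = x.
Proof. by rewrite -trM mulgV tr1. Qed.

Lemma tlK x s : l s^-1 (l s x) = x.
Proof. by rewrite -tlM mulVg tl1. Qed.

Lemma tlKV x s : l s (l s^-1 x) = x.
Proof. by rewrite -tlM mulgV tl1. Qed.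

Lemma tp_eq_r x y s : pr y = pr x * cS s -> exists t, y = r x t.
Proof.
rewrite -tp_r => /esym/(@tp_inj _ _ _ _ T)[z _ ->].
by exists (s * z); rewrite trM.
Qed.

Lemma tp_cent x z : z \in Z -> pr (r x z) = pr x.
Proof. by rewrite -cS_eq1 tp_r => /eqP->; rewrite mulg1. Qed.

End OneTorsor.

(** Let [D] consist of the [s] whose left action on [x] is a right action of an element [psi s] of
    [P]. For any [y0] over [tp T x * a], the fibres being Z(Q)-orbits, [D] also acts on [y0] through
    right translations, by some [chi]. Both [chi] and [f \o psi] are in [F] and agree on [Q], so
    they differ by conjugation by some [z] in Z(Q), and [y0] is corrected by [z]. *)
Lemma biset_map_local X X' (T : torsor F Q X) (T' : torsor F Q X') P f a x :
    inF F P f -> Q \subset P -> a \in AutF F Q -> {in Q, ap a =1 f} ->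
  exists y, tp T' y = tp T x * a /\
    (forall s u, u \in P -> tl T s x = tr T x u -> tl T' s y = tr T' y (f u)).
Proof.
move=> Ff sQP Fa ea.
have [y0 py0] := tp_surj T' (groupM (tp_Aut T x) Fa).
pose D := [set s | `[< exists2 u, u \in P & tl T s x = tr T x u >]].
have DP s : reflect (exists2 u, u \in P & tl T s x = tr T x u) (s \in D).
  by rewrite inE; apply: asboolP.
have gD : group_set D.
  apply/group_setP; split; first by apply/DP; exists 1; rewrite ?tl1 ?tr1.
  move=> s t /DP[u Pu su] /DP[v Pv tv]; apply/DP; exists (u * v); first exact: groupM.
  by rewrite tlM tv tlr su trM.
pose DG := Group gD; have sQD : Q \subset DG.
  apply/subsetP=> u Qu; apply/DP; exists (ap (tp T x) u); last exact: tl_Q.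
  by rewrite (subsetP sQP) ?ap_mem.
have [|psi psiP] :=
  @choice S S (fun s u => s \in D -> u \in P /\ tl T s x = tr T x u).
  move=> s; case: (boolP (s \in D)) => [/DP[u Pu su] | _]; last by exists 1.
  by exists u.
have Fpsi : inF F DG psi by apply: (t_inF (t0 := T) (x := x) sQD) => s /psiP[].
have psiD s : s \in DG -> psi s \in P by case/psiP.
have Ffpsi := inF_comp Fpsi Ff psiD.
have [|chi chiP] :=
  @choice S S (fun s t => s \in D -> tl T' s y0 = tr T' y0 t).
  move=> s; case: (boolP (s \in D)) => [Ds | _]; last by exists 1.
  have [Pu su] := psiP s Ds; suffices [t ->] : exists t, tl T' s y0 = tr T' y0 t by exists t.
  apply: (@tp_eq_r _ T' _ _ (f (psi s))); rewrite tp_l py0 mulgA -tp_l su tp_r.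
  by rewrite -!mulgA (cS_inF Ff sQP ea).
have Fchi : inF F DG chi by apply: (t_inF (t0 := T') (x := y0) sQD) => s /chiP.
have [|z Zz ez] := inF_eq_fnormal pS satF cQ nQ Fchi Ffpsi sQD.
  move=> u Qu /=; have Du := subsetP sQD u Qu.
  have [_ ux] := psiP u Du; have uy := chiP u Du.
  rewrite tl_Q // in ux; rewrite tl_Q // in uy.
  by rewrite -(tr_inj ux) -(tr_inj uy) py0 apM ea ?ap_mem.
exists (tr T' y0 z); split=> [|s u Pu su]; first by rewrite tp_cent.
have Ds : s \in D by apply/DP; exists u.
have [_ su'] := psiP s Ds; rewrite su in su'; have /= ezs := ez s Ds.
by rewrite (tr_inj su') ezs tlr chiP // -!trM conjgE mulKVg.
Qed.

(** The map is built on each orbit of [S] (left) and [P] (right) separately, by translating the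
    image of a representative given by [biset_map_local]. *)
Lemma biset_map X X' (T : torsor F Q X) (T' : torsor F Q X') P f a :
    inF F P f -> Q \subset P -> a \in AutF F Q -> {in Q, ap a =1 f} ->
  exists e : X -> X', [/\ forall x, tp T' (e x) = tp T x * a,
    forall s x, e (tl T s x) = tl T' s (e x)
    & forall x u, u \in P -> e (tr T x u) = tr T' (e x) (f u)].
Proof.
move=> Ff sQP Fa ea.
pose R x y := exists s u, u \in P /\ y = tl T s (tr T x u).
have [|x y [s [u [Pu ->]]]|x y z [s [u [Pu ->]]] [t [v [Pv ->]]]|rep repP rep_eq] :=
    @choose_representatives X R.
- by move=> x; exists 1, 1; rewrite tl1 tr1.
- by exists s^-1, u^-1; rewrite groupV -tlr tlK trK.
- by exists (t * s), (u * v); rewrite groupM // trM tlM !tlr.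
have [y yP] := choice (fun x => biset_map_local T T' x Ff sQP Fa ea).
(* Two expressions of one point mean that t^-1 s on the left of [x] acts as v u^-1 on its right. The
   point [y x] inherits this relation, so the value of the map is well defined. *)
have yW x s u t v : u \in P -> v \in P ->
    tl T s (tr T x u) = tl T t (tr T x v) ->
  tl T' s (tr T' (y x) (f u)) = tl T' t (tr T' (y x) (f v)).
  move=> Pu Pv est; have [_ /(_ (t^-1 * s) (v * u^-1))] := yP x.
  rewrite groupM ?groupV // => /(_ isT) yx.
  have {yx}: tl T' (t^-1 * s) (y x) = tr T' (y x) (f (v * u^-1)).
    by apply: yx; rewrite trM -(tlK T (tr T x v) t) -est !tlr trK tlM.
  rewrite (inF_M Ff) ?groupV // (inF_V Ff) // tlM => eyx.
  have {eyx}: tl T' s (y x) = tl T' t (tr T' (y x) (f v * (f u)^-1)).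
    by rewrite -eyx tlKV.
  by move=> eyx; rewrite tlr eyx -tlr -trM mulgKV.
have [|e eP] := @choice X X' (fun x x' => exists s u, [/\ u \in P,
    x = tl T s (tr T (rep x) u) & x' = tl T' s (tr T' (y (rep x)) (f u))]).
  move=> x; have [s [u [Pu def_x]]] := repP x.
  have {}def_x : x = tl T s^-1 (tr T (rep x) u^-1) by rewrite def_x -tlr tlK trK.
  exists (tl T' s^-1 (tr T' (y (rep x)) (f u^-1))), s^-1, u^-1.
  by rewrite groupV.
exists e; split=> [x | t x | x v Pv].
- have [s [u [Pu def_x ->]]] := eP x; have [yx _] := yP (rep x).
  by rewrite [in RHS]def_x !tp_l !tp_r yx -!mulgA (cS_inF Ff sQP ea).
- have [s [u [Pu def_x ->]]] := eP x; have [s' [u' [Pu' def_tx ->]]] := eP (tl T t x).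
  have rtx : rep (tl T t x) = rep x by apply/esym/rep_eq; exists t, 1; rewrite tr1.
  by rewrite rtx in def_tx *; rewrite -tlM; apply: yW; rewrite // tlM -def_x.
have [s [u [Pu def_x ->]]] := eP x; have [s' [u' [Pu' def_xv ->]]] := eP (tr T x v).
have rxv : rep (tr T x v) = rep x by apply/esym/rep_eq; exists 1, v; rewrite tl1.
rewrite rxv in def_xv *; rewrite -tlr -trM -(inF_M Ff) //; apply: yW => //.
  exact: groupM.
by rewrite -def_xv trM tlr -def_x.
Qed.

End Torsors.

Import GRing.Theory FiniteModule.

(** * Products over left orbits *)

Section AbelianProducts.

Variables (gT : finGroupType) (A : {group gT}) (abelA : abelian A) (I : finType).
Implicit Types (P : pred I) (h k : I -> gT).

(* A factor outside A counts as 1. *)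
Definition aprod P h : gT := fmval (\sum_(i | P i) fmod abelA (h i))%R.

Lemma aprod_mem P h : aprod P h \in A.
Proof. exact: fmodP. Qed.

Lemma eq_aprod P h k : (forall i, h i = k i) -> aprod P h = aprod P k.
Proof. by move=> ehk; congr fmval; apply: eq_bigr => i _; rewrite ehk. Qed.

Lemma aprodM P h k : (forall i, h i \in A) -> (forall i, k i \in A) ->
  aprod P (fun i => h i * k i) = aprod P h * aprod P k.
Proof.
move=> Ah Ak; rewrite -[RHS]fmvalA -big_split /=; congr fmval.
by apply: eq_bigr => i _; rewrite fmodM.
Qed.

Lemma aprod_const P z : z \in A -> aprod P (fun=> z) = z ^+ #|P|.
Proof.
by move=> Az; rewrite /aprod sumr_const [fmval _]fmvalZ fmodK.
Qed.

Lemma aprod_morph P h (b : gT -> gT) : {in A &, {morph b : x y / x * y}} ->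
    {in A, forall x, b x \in A} -> (forall i, h i \in A) ->
  aprod P (fun i => b (h i)) = b (aprod P h).
Proof.
move=> bM Ab Ah; have b1 : b 1 = 1 by apply: (mulgI (b 1)); rewrite -bM ?mulg1.
have -> : aprod P h = (\prod_(i | P i) h i)%g.
  rewrite /aprod fmval_sum; apply: eq_bigr => i _; exact: fmodK.
rewrite /aprod fmval_sum.
transitivity (\prod_(i | P i) b (h i))%g.
  by apply: eq_bigr => i _; apply: fmodK; rewrite Ab.
have [//] : b (\prod_(i | P i) h i) = \prod_(i | P i) b (h i) /\ \prod_(i | P i) h i \in A.
elim/big_rec2: _ => [//|i x y _ [<- Ay]]; split; first by rewrite bM.
by rewrite groupM.
Qed.

(** The map sending [x] to [rep (e x)] is injective on the finite set of representatives, hence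
    permutes it, and [h] takes the same value at [e x] and [rep (e x)]. *)
Lemma aprod_reindex (rep e : I -> I) h : (forall x, h (rep x) = h x) ->
    (forall x, rep (rep x) = rep x) ->
    {in [pred x | rep x == x] &, injective (fun x => rep (e x))} ->
  aprod [pred x | rep x == x] (fun x => h (e x)) = aprod [pred x | rep x == x] h.
Proof.
move=> hrep repK inj_e; congr fmval.
pose Y := [set x | rep x == x]; pose k x := rep (e x).
have kY : k @: Y = Y.
  apply/eqP; rewrite eqEcard card_in_imset ?leqnn ?andbT.
    by apply/subsetP=> _ /imsetP[x _ ->]; rewrite inE /k repK.
  by move=> x y; rewrite !inE => Yx Yy; apply: inj_e.
transitivity (\sum_(x in k @: Y) fmod abelA (h x))%R; last first.
  by rewrite kY; apply: eq_bigl => x; rewrite !inE.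
rewrite big_imset /=; last by move=> x y; rewrite !inE => Yx Yy; apply: inj_e.
by apply: eq_big => x; rewrite ?inE // /k hrep.
Qed.

End AbelianProducts.

Section FiniteTorsor.

Variables (p : nat) (S : finGroupType) (F : fusion_system S) (Q : {group S}).
Hypotheses (pS : p.-group [set: S]) (satF : saturated F p).
Hypotheses (cQ : centric F Q) (nQ : fnormal F Q).

Variables (X : finType) (T : torsor F Q X).
Local Notation l := (tl T).
Local Notation r := (tr T).
Local Notation pr := (tp T).
Local Notation Z := 'Z(Q).

Lemma tr_Q x u : u \in Q -> r x u = l (ap (pr x)^-1 u) x.
Proof. by move=> Qu; rewrite tl_Q ?ap_mem // (apKV (pr x) Qu). Qed.

Lemma orbit_representatives : exists rep : X -> X,
  (forall x, exists s, rep x = l s x) /\ (forall s x, rep (l s x) = rep x).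
Proof.
have [|x y [s ->]|x y z [s ->] [t ->]|rep repP rep_eq] :=
    @choose_representatives X (fun x y => exists s, y = l s x).
- by move=> x; exists 1; rewrite tl1.
- by exists s^-1; rewrite tlK.
- by exists (t * s); rewrite tlM.
by exists rep; split=> // s x; apply/esym/rep_eq; exists s.
Qed.

Variable rep : X -> X.
Hypotheses (repP : forall x, exists s, rep x = l s x).
Hypothesis (rep_l : forall s x, rep (l s x) = rep x).

Lemma repK x : rep (rep x) = rep x.
Proof. by have [s e] := repP x; rewrite {1}e rep_l. Qed.

Lemma rep_eq x y : rep x = rep y -> exists s, y = l s x.
Proof.
have [[s ->] [t ->]] := (repP x, repP y); move=> e_xy.
by exists (t^-1 * s); rewrite tlM e_xy tlK.
Qed.

(** The orbit of [x] corresponds to the coset [AutS Q :* pr x]. Injectivity holds because points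
    with the same image differ by Z(Q) on the right, and right translation by [Q] stays in the left
    orbit ([tr_Q]). *)
Lemma card_orbits : #|[pred x | rep x == x]| = #|AutF F Q : AutS Q|.
Proof.
rewrite -cardsE -(card_in_imset (f := fun x => AutS Q :* pr x)).
  apply/eq_card => C; apply/imsetP/rcosetsP => [[x _ ->]|[a Fa ->]].
    by exists (pr x) => //; apply: tp_Aut.
  have [x prx] := tp_surj T Fa; exists (rep x); first by rewrite !inE repK.
  have [s ->] := repP x; rewrite tp_l prx.
  by apply/esym/rcoset_eqP; rewrite mem_rcoset mulgK mem_AutS ?(norm_fnormal nQ).
move=> x y; rewrite !inE => /eqP rx /eqP ry /rcoset_eqP.
rewrite mem_rcoset => /AutSP[]; first by apply/setP=> s; rewrite (norm_fnormal nQ) inE.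
move=> s def_s; have : pr x = pr (l s y) by rewrite tp_l -def_s mulgKV.
case/(@tp_inj _ _ _ _ T) => z /setIP[Qz _] def_y.
have : l s^-1 (r x z) = y by rewrite -def_y tlK.
by rewrite tr_Q // => yx; rewrite -rx -ry -yx !rep_l.
Qed.

Lemma coprime_orbits : coprime #|Z| #|[pred x | rep x == x]|.
Proof.
rewrite card_orbits; have /pHallP[_ cardT] := Sylow_AutS satF nQ.
have /and3P[_ _ p'T] := Sylow_AutS satF nQ.
exact: pnat_coprime (pgroupS (subsetT Z) pS) p'T.
Qed.

Lemma aprod_equivariant (abelZ : abelian Z) (e : X -> X) h :
    injective e -> (forall s x, e (l s x) = l s (e x)) ->
    (forall s x, h (l s x) = h x) ->
  aprod abelZ [pred x | rep x == x] (fun x => h (e x)) =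
  aprod abelZ [pred x | rep x == x] h.
Proof.
move=> inj_e el hl; apply: aprod_reindex => [x||x y]; last 1 first.
- rewrite !inE => /eqP rx /eqP ry /rep_eq[s]; rewrite -el => /inj_e def_y.
  by rewrite -rx -ry def_y rep_l.
- by have [s ->] := repP x.
exact: repK.
Qed.

End FiniteTorsor.

(** The type [coset_of N] carries the quotient of the whole normalizer of [N], so the quotient of
    [E] alone is taken as the type of elements of [E / N]. *)
Lemma quotient_morphism (gT : finGroupType) (E N : {group gT}) : N <| E ->
  exists (G : finGroupType) (f : {morphism E >-> G}),
    f @* E = [set: G] /\ 'ker f = N.
Proof.
move=> nNE; have nNE' := subsetP (normal_norm nNE).
have cE x : x \in E -> coset N x \in E / N by apply: mem_quotient.
have fM : {in E &, {morph (fun x => subg (E / N)%G (coset N x)) : x y / x * y}}.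
  by move=> x y Ex Ey; rewrite morphM ?nNE' // morphM ?cE.
exists (fingroup_subg_of__canonical__fingroup_FinGroup (E / N)%G), (Morphism fM); split.
  apply/eqP; rewrite -subTset; apply/subsetP=> y _.
  have /morphimP[x _ Ex def_y] := subgP y; apply/morphimP; exists x => //=.
  by rewrite -def_y sgvalK.
apply/setP=> x; rewrite [RHS](_ : _ = (x \in E) && (x \in N)); last first.
  by rewrite andb_idl // => /(subsetP (normal_sub nNE)).
rewrite !inE; apply: andb_id2l => Ex; apply/eqP/idP => /= [fx1 | Nx].
  apply: coset_idr (nNE' _ Ex) _.
  by have := congr1 val fx1; rewrite /= subgK ?cE.
by rewrite coset_id // morph1.
Qed.

(** * The model attached to a finite torsor *)

Section Extension.

Variables (p : nat) (S : finGroupType) (F : fusion_system S) (Q : {group S}).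
Hypotheses (pS : p.-group [set: S]) (satF : saturated F p).
Hypotheses (cQ : centric F Q) (nQ : fnormal F Q).

Local Notation Z := 'Z(Q).
Local Notation cS := (cperm Q).

(** The last hypothesis puts [P] inside [Nphi phi] for [phi] given by [a], and the image [Q] of
    [phi] is fully centralized, so the extension axiom applies. *)
Lemma saturated_extend a (P : {group S}) : a \in AutF F Q -> Q \subset P ->
    (forall s, s \in P -> exists t, cS s * a = a * cS t) ->
  exists2 k, inF F P k & {in Q, k =1 ap a}.
Proof.
move=> Fa sQP aP; have NQ := norm_fnormal nQ.
pose phi : Q ~> [set: S]%G := [ffun u => subg [set: S]%G (ap a (sgval u))].
have Fphi : phi \in fhom F Q [set: S]%G by apply: AutF_inF.
have phiE u : sgval (phi u) = ap a (sgval u) by rewrite ffunE subgK ?inE.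
have im_phi : fim phi = Q.
  apply/group_inj; rewrite (fimE (subsetP (fhom_Inj F _ _) _ Fphi)).
  apply/setP=> v; apply/imsetP/idP=> [[u _ ->]|Qv]; first by rewrite phiE ap_mem.
  by exists (subg Q (ap a^-1 v)); rewrite ?inE ?subgP // phiE subgK ?ap_mem ?apKV.
have [_ /(_ phi Fphi)[]] := satF Q.
  by rewrite im_phi; apply: fully_centralized_fnormal nQ _ (fconj_refl F Q).
move=> phibar Fphibar ext; have sPN : P \subset Nphi phi.
  apply/subsetP=> s Ps; rewrite NphiE inE NQ /=.
  have [t et] := aP s^-1 (groupVr Ps); apply/existsP; exists t^-1; apply/forallP=> u.
  rewrite invgK !phiE subgK ?memJ_norm ?NQ ?subgP //.
  by rewrite -!(ap_cperm (Q := Q)) ?NQ ?ap_mem ?subgP // -!apM et.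
exists (fun x => sgval (phibar (subg (Nphi phi) x))).
  exact: inF_sub sPN (fhom_inF Fphibar).
by move=> u Qu; rewrite ext // phiE subgK.
Qed.

Variables (X : finType) (T : torsor F Q X).
Local Notation l := (tl T).
Local Notation r := (tr T).
Local Notation pr := (tp T).

Definition tperms : {set {perm X}} :=
  [set e : {perm X} | [forall s, forall x, e (l s x) == l s (e x)]
     && [exists a in AutF F Q, forall x, pr (e x) == pr x * a]].

Lemma tpermsP (e : {perm X}) : reflect
  ((forall s x, e (l s x) = l s (e x)) /\
   (exists2 a, a \in AutF F Q & forall x, pr (e x) = pr x * a))
  (e \in tperms).
Proof.
rewrite inE; apply: (iffP andP) => [[el /exists_inP[a Fa ea]] | [el [a Fa ea]]].
  split=> [s x|]; first by have /forallP/(_ s)/forallP/(_ x)/eqP := el.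
  by exists a => // x; have /forallP/(_ x)/eqP := ea.
split; first by apply/forallP=> s; apply/forallP=> x; apply/eqP.
by apply/exists_inP; exists a => //; apply/forallP=> x; apply/eqP.
Qed.

Lemma tperms_group_set : group_set tperms.
Proof.
apply/group_setP; split=> [|e e' /tpermsP[el [a Fa ea]] /tpermsP[el' [a' Fa' ea']]].
  by apply/tpermsP; split=> [s x|]; [|exists 1 => // x]; rewrite !perm1 ?mulg1.
apply/tpermsP; split=> [s x|]; first by rewrite !permM el el'.
by exists (a * a') => [|x]; rewrite ?groupM // permM ea' ea mulgA.
Qed.
Canonical tperms_group := Group tperms_group_set.

Variable x0 : X.

(** The homomorphism from E to Aut_F(Q). By [tactE] the base point [x0] can be replaced by any
    point. *)
Definition tact (e : {perm X}) : {perm subg_of Q} := (pr x0)^-1 * pr (e x0).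

Lemma tactE e x : e \in tperms -> pr (e x) = pr x * tact e.
Proof. by case/tpermsP=> _ [a _ ea]; rewrite /tact !ea mulKg. Qed.

Lemma tact_Aut e : e \in tperms -> tact e \in AutF F Q.
Proof. by case/tpermsP=> _ [a Fa ea]; rewrite /tact ea mulKg. Qed.

Lemma tactM : {in tperms &, {morph tact : e e' / e * e'}}.
Proof.
move=> e e' Ee Ee'; apply: (mulgI (pr x0)).
by rewrite [RHS]mulgA -!tactE ?groupM // permM.
Qed.
Canonical tact_morphism := Morphism tactM.

Lemma tr_inj_l s : injective (fun x => r x s).
Proof. by move=> x y /(congr1 (fun w => r w s^-1)); rewrite !trK. Qed.

Definition rperm s : {perm X} := perm (@tr_inj_l s).

Lemma rpermE s x : rperm s x = r x s.
Proof. by rewrite permE. Qed.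

Lemma rpermM : {morph rperm : s t / s * t}.
Proof. by move=> s t; apply/permP=> x; rewrite permM !rpermE trM. Qed.

Lemma AutS_Aut s : cS s \in AutF F Q.
Proof. by apply: (subsetP (AutS_sub_AutF F Q)); rewrite mem_AutS ?(norm_fnormal nQ). Qed.

Lemma rperm_mem s : rperm s \in tperms.
Proof.
apply/tpermsP; split=> [t x|]; first by rewrite !rpermE tlr.
by exists (cS s); [apply: AutS_Aut | move=> x; rewrite rpermE tp_r].
Qed.

Lemma tact_rperm s : tact (rperm s) = cS s.
Proof. by rewrite /tact rpermE tp_r mulKg. Qed.

Lemma tperm_l e s x : e \in tperms -> e (l s x) = l s (e x).
Proof. by case/tpermsP. Qed.

Lemma tperm_Q e x u : e \in tperms -> u \in Q -> e (r x u) = r (e x) (ap (tact e) u).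
Proof.
move=> Ee Qu; rewrite tr_Q // tperm_l // tl_Q ?ap_mem // tactE // apM.
by rewrite (apKV (pr x) Qu).
Qed.

Lemma rperm_conj_Q e u : e \in tperms -> u \in Q -> rperm u ^ e = rperm (ap (tact e) u).
Proof.
move=> Ee Qu; apply: (mulgI e); rewrite -conjgC; apply/permP=> x.
by rewrite !permM !rpermE tperm_Q.
Qed.

(* On a permutation e acting trivially on Q this is the map zeta : X -> Z(Q)
   with e x = x zeta(x). *)
Definition tzeta (e : {perm X}) x : S := odflt 1 [pick z in Z | e x == r x z].

Lemma tzetaP e x : e \in tperms -> tact e = 1 ->
  tzeta e x \in Z /\ e x = r x (tzeta e x).
Proof.
move=> Ee e1; rewrite /tzeta; case: pickP => [z /andP[Zz /eqP->] // | noz].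
have : pr x = pr (e x) by rewrite tactE // e1 mulg1.
by case/(@tp_inj _ _ _ _ T)=> z Zz ez; have := noz z; rewrite Zz ez eqxx.
Qed.

Lemma tzeta_eq e x z : e \in tperms -> tact e = 1 -> e x = r x z -> tzeta e x = z.
Proof.
move=> Ee e1 exz; have [_] := tzetaP x Ee e1; rewrite exz => rz.
by apply/esym; apply: (tr_inj _ _ rz).
Qed.

Lemma tzeta_l e s x : e \in tperms -> tact e = 1 -> tzeta e (l s x) = tzeta e x.
Proof.
move=> Ee e1; apply: tzeta_eq => //.
by rewrite tperm_l // (tzetaP x Ee e1).2 tlr.
Qed.

Variable rep : X -> X.
Hypotheses (repP : forall x, exists s, rep x = l s x).
Hypothesis (rep_l : forall s x, rep (l s x) = rep x).

Local Notation abelZ := (center_abelian Q).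
Local Notation Y := [pred x | rep x == x].

(** The product of zeta over S\X; by [tzeta_l] it does not depend on the representatives. On the
    kernel of [tact] it is a homomorphism to the abelian group Z(Q). *)
Definition ttau e : S := aprod abelZ Y (tzeta e).

Lemma ttauM e e' : e \in tperms -> tact e = 1 -> e' \in tperms -> tact e' = 1 ->
  ttau (e * e') = ttau e' * ttau e.
Proof.
move=> Ee e1 Ee' e1'; rewrite -aprodM; first last.
- by move=> x; case: (tzetaP x Ee e1).
- by move=> x; case: (tzetaP x Ee' e1').
apply: eq_aprod => x; have [Zx ex] := tzetaP x Ee e1; have [_ ex'] := tzetaP x Ee' e1'.
have Qx : tzeta e x \in Q by case/setIP: Zx.
apply: tzeta_eq; rewrite ?groupM // ?tactM // ?e1 ?e1' ?mulg1 //.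
by rewrite permM ex tperm_Q // e1' ap1 // ex' trM.
Qed.

Lemma ttau_rperm z : z \in Z -> ttau (rperm z) = z ^+ #|Y|.
Proof.
move=> Zz; rewrite -(aprod_const abelZ) //; apply: eq_aprod => x.
apply: tzeta_eq (rpermE z x); rewrite ?rperm_mem // tact_rperm.
by apply/eqP; rewrite (cS_eq1 cQ nQ).
Qed.

(** The value of zeta for [m ^ e] at [e x] is the image under [tact e] of its value for [m] at [x],
    and [e] permutes the left orbits over which the product runs. *)
Lemma ttauJ m e : m \in tperms -> tact m = 1 -> e \in tperms ->
  ttau (m ^ e) = ap (tact e) (ttau m).
Proof.
move=> Em m1 Ee; have Ea := AutF_inF (tact_Aut Ee).
have mZ x : tzeta m x \in Z by case: (tzetaP x Em m1).
have sZQ := subsetP (center_sub Q).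
have aZ := fnormal_center cQ nQ Ea (subxx Q).
rewrite /ttau -(aprod_morph _ _ (b := ap (tact e))) //; last first.
  by move=> x y Zx Zy; rewrite (inF_M Ea) ?sZQ.
have Eme : m ^ e \in tperms by rewrite groupJ.
have me1 : tact (m ^ e) = 1 by rewrite morphJ //= m1 conj1g.
rewrite -(aprod_equivariant repP rep_l abelZ (perm_inj (s := e))) //.
- apply: eq_aprod => x; apply: tzeta_eq => //.
  by rewrite -permM -conjgC permM (tzetaP x Em m1).2 tperm_Q ?sZQ.
- by move=> s x; apply: tperm_l.
by move=> s x; apply: tzeta_l.
Qed.

Definition tker : {set {perm X}} := [set e in tperms | (tact e == 1) && (ttau e == 1)].

Lemma tkerP e : reflect [/\ e \in tperms, tact e = 1 & ttau e = 1] (e \in tker).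
Proof.
apply: (iffP setIdP) => [[Ee /andP[/eqP e1 /eqP te]] | [Ee e1 te]] //.
by rewrite Ee e1 te !eqxx.
Qed.

Lemma tker_group_set : group_set tker.
Proof.
have t1 : tact 1 = 1 by rewrite morph1.
apply/group_setP; split=> [|e e' /tkerP[Ee e1 te] /tkerP[Ee' e1' te']].
  apply/tkerP; split=> //; apply: (mulgI (ttau 1)).
  by rewrite -ttauM ?mulg1.
by apply/tkerP; split; rewrite ?groupM // ?tactM // ?ttauM // ?e1 ?e1' ?te ?te' mulg1.
Qed.
Canonical tker_group := Group tker_group_set.

Lemma tker_normal : tker <| tperms.
Proof.
apply/andP; split; first by apply/subsetP=> e /tkerP[].
apply/subsetP=> e Ee; rewrite inE; apply/subsetP=> _ /imsetP[m /tkerP[Em m1 tm] ->].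
apply/tkerP; split; first by rewrite groupJ.
  by rewrite morphJ //= m1 conj1g.
by rewrite ttauJ // tm (inF_1 (AutF_inF (tact_Aut Ee))).
Qed.

Lemma tact1_decomp e : e \in tperms -> tact e = 1 ->
  exists2 z, z \in Z & e * rperm z \in tker.
Proof.
(* The number of orbits is prime to |Z(Q)|, so [z] is the root satisfying [z ^+ #|Y| = (ttau e)^-1];
   by [ttau_rperm] it cancels [ttau e]. *)
move=> Ee e1; pose z := (ttau e)^-1 ^+ expg_invn Z #|Y|.
have Zt : ttau e \in Z by apply: aprod_mem.
have Zz : z \in Z by rewrite groupX ?groupV.
have z1 : tact (rperm z) = 1 by rewrite tact_rperm; apply/eqP; rewrite (cS_eq1 cQ nQ).
exists z => //; apply/tkerP; split; rewrite ?groupM ?rperm_mem // ?tactM ?rperm_mem //.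
  by rewrite e1 z1 mulg1.
rewrite ttauM ?rperm_mem // ttau_rperm // /z.
rewrite -expgM mulnC expgM expgK ?groupV ?mulVg //.
exact: (coprime_orbits pS satF nQ repP rep_l).
Qed.

Variables (G : finGroupType) (f : {morphism tperms >-> G}).
Hypotheses (f_surj : f @* tperms = [set: G]) (ker_f : 'ker f = tker).

Let f_ex g : exists2 e, e \in tperms & g = f e.
Proof.
have /morphimP[e _ Ee ->] : g \in f @* tperms by rewrite f_surj inE.
by exists e.
Qed.

Let f_eq1 e : e \in tperms -> f e = 1 -> [/\ e \in tperms, tact e = 1 & ttau e = 1].
Proof. by move=> Ee fe1; apply/tkerP; rewrite -ker_f; apply/kerP. Qed.

Lemma torsor_embM : {in [set: S] &, {morph (fun s => f (rperm s)) : s t / s * t}}.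
Proof. by move=> s t _ _; rewrite rpermM morphM ?rperm_mem. Qed.
Definition torsor_emb := Morphism torsor_embM.
Local Notation i := torsor_emb.

(** An element [s] of the kernel acts trivially on [Q], so it lies in Z(Q), and [ttau] gives
    [s ^+ #|Y| = 1] with an exponent prime to |Z(Q)|. *)
Lemma torsor_emb_inj : 'injm torsor_emb.
Proof.
apply/subsetP=> s /morphpreP[_ /set1P /= fs1].
have [_ /eqP + s1] := f_eq1 (rperm_mem s) fs1; rewrite tact_rperm (cS_eq1 cQ nQ) => Zs.
apply/set1P; have coZn := coprime_orbits pS satF nQ repP rep_l.
by rewrite -(expgK (G := 'Z(Q)) coZn Zs) -ttau_rperm // s1 expg1n.
Qed.

Lemma torsor_tact1 e : e \in tperms -> tact e = 1 -> exists2 z, z \in Z & f e = i z.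
Proof.
move=> Ee e1; have [z Zz /tkerP[Eez ez1 tez]] := tact1_decomp Ee e1.
exists z^-1; rewrite ?groupV // morphV ?inE //=; apply/eqP; rewrite eq_mulgV1 invgK.
rewrite -morphM ?rperm_mem //; apply/eqP/(kerP _ Eez).
by rewrite ker_f; apply/tkerP.
Qed.

Lemma torsor_conj_Q e u : e \in tperms -> u \in Q -> i u ^ f e = i (ap (tact e) u).
Proof. by move=> Ee Qu; rewrite /= -rperm_conj_Q // morphJ ?rperm_mem. Qed.

Lemma tact_f e e' : e \in tperms -> e' \in tperms -> f e = f e' -> tact e = tact e'.
Proof.
move=> Ee Ee' eff; have Eee : e^-1 * e' \in tperms by rewrite groupM ?groupV.
have [|_ + _] := f_eq1 Eee; first by rewrite morphM ?groupV // morphV // eff mulVg.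
by rewrite tactM ?groupV // morphV //= => e1; apply/eqP; rewrite eq_mulVg1 e1.
Qed.

(** The preimage [H] of [S] in E contains the kernel of [tact] and maps onto Aut_S(Q). So |G : S|
    equals the index of Aut_S(Q) in the image of [tact], a divisor of |Aut_F(Q) : Aut_S(Q)|, which
    is prime to p. *)
Lemma torsor_Sylow : p.-Sylow([set: G]) (i @* [set: S]).
Proof.
pose H := (f @*^-1 (i @* [set: S]))%G.
have sHE : H \subset tperms by apply: subsetIl.
have kerH : 'ker tact \subset H.
  apply/subsetP=> e /morphpreP[Ee /set1P e1]; apply/morphpreP; split=> //.
  by have [z _ ->] := torsor_tact1 Ee e1; rewrite mem_morphim ?inE.
have tH : tact @* H = AutS Q.
  apply/setP=> a; apply/idP/idP=> [/morphimP[e _ /morphpreP[Ee]]|].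
    case/morphimP=> s _ _ /= efs ->; rewrite (tact_f Ee (rperm_mem s) efs).
    by rewrite tact_rperm mem_AutS ?(norm_fnormal nQ).
  case/AutSP=> [|s ->]; first by apply/setP=> s; rewrite (norm_fnormal nQ) inE.
  rewrite -tact_rperm mem_morphim ?rperm_mem //.
  by apply/morphpreP; rewrite rperm_mem; split=> //; apply: (mem_morphim i); rewrite inE.
have index_i : #|[set: G] : i @* [set: S]| = #|tact @* tperms : AutS Q|.
  have defH : tact @*^-1 (tact @* H) = H by rewrite morphimGK.
  have defE : tact @*^-1 (tact @* tperms) = tperms.
    by rewrite morphimGK // (subset_trans kerH).
  have pre_f : f @*^-1 [set: G] = tperms.
    by rewrite -f_surj morphimK // ker_f mulSGid ?normal_sub ?tker_normal.
  rewrite -tH -(index_morphpre (f := tact_morphism) (tact @* H) (subxx (tact @* tperms))) /=.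
  rewrite defE defH.
  by rewrite -(index_morphpre (f := f) (i @* [set: S])%G) /= ?f_surj // pre_f.
have /and3P[sTA _ p'T] := Sylow_AutS satF nQ.
rewrite /pHall subsetT morphim_pgroup //= index_i.
have sEA : tact @* tperms \subset AutF F Q.
  by apply/subsetP=> _ /morphimP[e Ee _ ->]; apply: tact_Aut.
have sTE : AutS Q \subset tact @* tperms by rewrite -tH morphimS.
by apply: pnat_dvd p'T; rewrite -(Lagrange_index sEA sTE) dvdn_mull.
Qed.

Definition torsor_sylow := SylowEmbedding torsor_emb_inj torsor_Sylow.

Lemma torsor_normal : i @* Q <| [set: G].
Proof.
rewrite /normal subsetT; apply/subsetP=> g _; have [e Ee ->] := f_ex g.
rewrite inE; apply/subsetP=> _ /imsetP[_ /morphimP[u _ Qu ->] ->].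
by rewrite torsor_conj_Q // mem_morphim ?inE ?ap_mem.
Qed.

Lemma torsor_cent : 'C(i @* Q) \subset i @* Q.
Proof.
apply/subsetP=> g; have [e Ee ->] := f_ex g => /centP ce.
have [|z /setIP[Qz _] ->] := @torsor_tact1 e Ee; last by rewrite mem_morphim ?inE.
apply: ap_eq => u Qu; rewrite ap1 //; have Ii := injmP torsor_emb_inj.
apply: Ii; rewrite ?inE // -torsor_conj_Q //; apply/conjg_fixP/commgP/commute_sym/ce.
by rewrite mem_morphim ?inE.
Qed.

Lemma torsor_p_constrained : p_constrained p G.
Proof.
exists (i @* Q)%G; first exact: torsor_normal.
by rewrite torsor_cent morphim_pgroup // (pgroupS (subsetT _) pS).
Qed.

(** A normal p'-subgroup meets the normal p-subgroup [i @* Q] trivially, so it centralizes it and is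
    contained in it by [torsor_cent]. *)
Lemma torsor_p'_reduced : p'_reduced p G.
Proof.
move=> N nNG p'N.
have pQ : p.-group (i @* Q) by rewrite morphim_pgroup // (pgroupS (subsetT _) pS).
have tiNQ : N :&: i @* Q = 1 by rewrite setIC coprime_TIg // (pnat_coprime pQ).
have cNQ : N \subset 'C(i @* Q).
  rewrite (sameP commG1P eqP) -subG1 -tiNQ subsetI commg_subl commg_subr.
  have [/andP[_ nN] /andP[_ nQG]] := (nNG, torsor_normal).
  by rewrite (subset_trans (subsetT _) nN) (subset_trans (subsetT _) nQG).
by apply/trivgP; rewrite -tiNQ subsetI subxx (subset_trans cNQ torsor_cent).
Qed.

(** A biset map from [X] to itself, twisted by [k] on the right, is injective, hence a permutation
    in E; its equivariance says that it conjugates right translation by [s] to that by [k s]. *)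
Lemma torsor_realize P k : inF F P k -> Q \subset P ->
  exists2 e, e \in tperms & {in Q, ap (tact e) =1 k} /\ {in P, forall s, i s ^ f e = i (k s)}.
Proof.
move=> Fk sQP; have [a Fa ea] := inF_restrict nQ Fk sQP.
have [h [ph hl hr]] := biset_map pS satF cQ nQ T T Fk sQP Fa ea.
have inj_h : injective h.
  move=> x y ehxy; have : pr x = pr y by apply: (mulIg a); rewrite -!ph ehxy.
  case/(@tp_inj _ _ _ _ T)=> z /setIP[Qz _] def_y; have Pz := subsetP sQP z Qz.
  rewrite def_y hr // -{1}(tr1 T (h x)) -{1}(inF_1 Fk) in ehxy.
  by rewrite def_y -(inF_inj Fk (group1 P) Pz (tr_inj cQ nQ ehxy)) tr1.
have he x : perm inj_h x = h x by rewrite permE.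
have Ee : perm inj_h \in tperms.
  apply/tpermsP; split=> [s x|]; first by rewrite !he hl.
  by exists a => // x; rewrite he ph.
exists (perm inj_h) => //; split=> [u Qu|s Ps].
  by rewrite -ea // /tact he ph mulKg.
rewrite /= -morphJ ?rperm_mem //; congr (f _); apply: (mulgI (perm inj_h)).
by rewrite -conjgC; apply/permP=> x; rewrite !permM !rpermE !he hr.
Qed.

Lemma torsor_fusion : fusion_eq F (FSG torsor_sylow).
Proof.
move=> P P'; apply/setP=> phi; apply/idP/idP=> [Fphi | ].
  have [k [Fk ek _]] := inF_extend nQ (fhom_inF Fphi).
  have [e Ee [_ eJ]] := torsor_realize Fk (joing_subr P Q).
  rewrite inE; apply/existsP; exists (f e)^-1; apply/forallP=> u; rewrite invgK.
  have Pu : sgval u \in P by apply: subgP.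
  by rewrite [_ ^ _]eJ ?(subsetP (joing_subl P Q)) // ek // sgvalK.
(* Conversely, let [P1] be the group of all [s] that [f e] conjugates into [S]; it contains [P] and
   [Q]. By saturation [tact e] extends to some [k] on [P1], realized by some [e']. Then [e] and [e']
   agree on [Q], so [f e] and [f e'] differ by Z(Q). *)
rewrite inE => /existsP[g /forallP phiE]; have [e Ee def_g] := f_ex g^-1.
pose P1 := (i @*^-1 (i @* [set: S] :^ (f e)^-1))%G.
have mem_P1 s t : i s ^ f e = i t -> s \in P1.
  by move=> est; apply/morphpreP; rewrite inE mem_conjgV est mem_morphim ?inE.
have sPP1 : P \subset P1.
  apply/subsetP=> u Pu; apply: (mem_P1 _ (sgval (phi (subg P u)))).
  by have /eqP := phiE (subg P u); rewrite subgK // def_g.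
have sQP1 : Q \subset P1.
  by apply/subsetP=> u Qu; apply: mem_P1 (torsor_conj_Q Ee Qu).
have P1P s : s \in P1 -> exists t, i s ^ f e = i t.
  case/morphpreP=> _; rewrite mem_conjgV => /morphimP[t _ _ ->].
  by exists t.
have Fa := tact_Aut Ee.
have tP1 s t : i s ^ f e = i t -> cS s * tact e = tact e * cS t.
  rewrite -!tact_rperm -!tactM ?rperm_mem // => est.
  apply: tact_f; rewrite ?groupM ?rperm_mem // !morphM ?rperm_mem //.
  by rewrite conjgC [_ ^ _]est.
have [|k Fk ek] := saturated_extend Fa sQP1.
  by move=> s /P1P[t est]; exists t; apply: tP1 est.
have [e' Ee' [ea' eJ']] := torsor_realize Fk sQP1.
have eaa : tact e' = tact e by apply: ap_eq => u Qu; rewrite ea' ?ek.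
have Eee : e'^-1 * e \in tperms by rewrite groupM ?groupV.
have [|z Zz ez] := torsor_tact1 Eee.
  by rewrite tactM ?groupV // morphV //= eaa mulVg.
have fe : f e = f e' * i z by rewrite -ez morphM ?groupV // morphV // mulKVg.
apply: (inF_fhom (f := fun s => k s ^ z)) => [|u].
  apply: (inF_comp (inF_sub sPP1 Fk) (inF_conj F [set: S]%G z)) => s _.
  by rewrite inE.
apply: (injmP torsor_emb_inj); rewrite ?inE // morphJ ?inE //.
have Pu : sgval u \in P1 by rewrite (subsetP sPP1) ?subgP.
by have /eqP := phiE u; rewrite def_g fe conjgM [i _ ^ _]eJ'.
Qed.

End Extension.

Lemma torsor_model (p : nat) (S : finGroupType) (F : fusion_system S) (Q : {group S})
    (X : finType) : p.-group [set: S] -> saturated F p -> centric F Q -> fnormal F Q ->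
    torsor F Q X ->
  exists (G : finGroupType) (e : sylow_embedding p S G),
    [/\ p'_reduced p G, p_constrained p G & fusion_eq F (FSG e)].
Proof.
move=> pS satF cQ nQ T; have [x0 _] := tp_surj T (group1 _).
have [rep [repP rep_l]] := orbit_representatives T.
have [G [f [f_surj ker_f]]] := quotient_morphism (tker_normal cQ nQ x0 repP rep_l).
exists G, (torsor_sylow pS satF cQ nQ repP rep_l f_surj ker_f); split.
- exact: (torsor_p'_reduced pS satF cQ nQ repP rep_l f_surj ker_f).
- exact: (torsor_p_constrained pS satF cQ nQ repP rep_l f_surj ker_f).
exact: torsor_fusion.
Qed.

(** * A finite torsor inside Sym(S) *)

Section RegularBiset.

Variables (p : nat) (S : finGroupType) (F : fusion_system S) (Q : {group S}).
Hypotheses (pS : p.-group [set: S]) (satF : saturated F p).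
Hypotheses (cQ : centric F Q) (nQ : fnormal F Q).
Implicit Types (P : {group S}) (x y : {perm S}) (a c : {perm subg_of Q}).

Local Notation Z := 'Z(Q).
Local Notation cS := (cperm Q).
Local Notation inNQ := (norm_fnormal nQ).

Definition rmul (s : S) : {perm S} := perm (@mulIg S s).

Lemma rmulE s t : rmul s t = t * s.
Proof. by rewrite permE. Qed.

Lemma rmulM : {morph rmul : s t / s * t}.
Proof. by move=> s t; apply/permP=> w; rewrite permM !rmulE mulgA. Qed.

Lemma rmul1 : rmul 1 = 1.
Proof. by apply/permP=> w; rewrite rmulE perm1 mulg1. Qed.

Lemma rmulV s : rmul s^-1 = (rmul s)^-1.
Proof. by apply: (mulgI (rmul s)); rewrite -rmulM !mulgV rmul1. Qed.

Lemma rmul_inj : injective rmul.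
Proof. by move=> s t /permP/(_ 1); rewrite !rmulE !mul1g. Qed.

(* S acts semiregularly through both rmul and rmul \o f, with equally many orbits. *)
Lemma rmul_realize P f : inF F P f ->
  exists x, forall s, s \in P -> rmul s * x = x * rmul (f s).
Proof.
move=> Ff; pose R := Group (inF_group_set Ff).
have cardR : #|R| = #|P| by rewrite card_in_imset //; apply: inF_inj Ff.
pose cP := enum (lcosets P [set: S]); pose cR := enum (lcosets R [set: S]).
have eq_size : size cP = size cR.
  rewrite -!cardE !card_lcosets; apply/eqP.
  by rewrite -(eqn_pmul2l (cardG_gt0 P)) -{2}cardR !Lagrange ?subsetT.
pose b t := nth set0 cR (index (t *: P) cP).
have inP t : t *: P \in cP by rewrite mem_enum; apply/lcosetsP; exists t; rewrite ?inE.
have b_inj t t' : b t = b t' -> t *: P = t' *: P.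
  move/eqP; rewrite nth_uniq ?enum_uniq -?eq_size ?index_mem // => /eqP e_ix.
  by rewrite -(nth_index set0 (inP t)) e_ix nth_index.
(* Each [t] is the representative of its coset times [q t] in [P]. Matching the cosets of [P] with
   those of [R] by [b], and applying [f] to the second factor, gives g(t s) = g(t) f(s) for [s] in
   [P]. *)
pose q t := (repr (t *: P))^-1 * t; pose g t := repr (b t) * f (q t).
have qP t : q t \in P.
  have /lcosetP[u Pu def_r] := mem_repr t (lcoset_refl P t).
  by rewrite /q def_r invMg mulgKV groupV.
have bg t : b t = g t *: R.
  have /lcosetsP[w _ bw] : b t \in lcosets R [set: S].
    by rewrite -mem_enum mem_nth // -eq_size index_mem.
  rewrite lcosetM lcoset_id; last by apply: imset_f.
  rewrite bw; have /lcosetP[u Ru ->] := mem_repr w (lcoset_refl R w).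
  by rewrite lcosetM (lcoset_id Ru).
have g_inj : injective g.
  move=> t t' e_g; have e_b : b t = b t' by rewrite !bg e_g.
  have e_P := b_inj _ _ e_b; move: e_g; rewrite /g e_b => /mulgI/(inF_inj Ff (qP t) (qP t')).
  by rewrite /q e_P => /mulgI.
exists (perm g_inj) => s Ps; apply/permP=> t; rewrite !permM !rmulE !permE /g /b /q.
by rewrite lcosetM lcoset_id // -!mulgA -(inF_M Ff) ?mulgA // qP.
Qed.

Definition acts_as x a := forall u, u \in Q -> rmul u * x = x * rmul (ap a u).

Lemma acts_as_eq x a c : acts_as x a -> acts_as x c -> a = c.
Proof.
move=> xa xc; apply: ap_eq => u Qu; apply: rmul_inj; apply: (mulgI x).
by rewrite -xa // xc.
Qed.

Lemma acts_as_l x a s : acts_as x a -> acts_as (rmul s * x) (cS s * a).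
Proof.
move=> xa u Qu; have NQ := inNQ s; rewrite apM ap_cperm // -mulgA -xa ?memJ_norm //.
by rewrite !mulgA -!rmulM -conjgC.
Qed.

Lemma acts_as_r x a s : acts_as x a -> acts_as (x * rmul s) (a * cS s).
Proof.
move=> xa u Qu; rewrite apM ap_cperm ?inNQ ?ap_mem // mulgA xa // -!mulgA -!rmulM.
by rewrite -conjgC.
Qed.

(** This is N_phi for the morphism [a] on [Q], the domain to which saturation extends it. *)
Definition conj_stable a := [set s | [exists t, cS s * a == a * cS t]].

Lemma conj_stableP a s : reflect (exists t, cS s * a = a * cS t) (s \in conj_stable a).
Proof. by rewrite inE; apply: (iffP existsP) => -[t /eqP]; exists t => //; apply/eqP. Qed.

Lemma conj_stable_group_set a : group_set (conj_stable a).
Proof.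
apply/group_setP; split; first by apply/conj_stableP; exists 1; rewrite cS1 // mul1g mulg1.
move=> s s' /conj_stableP[t et] /conj_stableP[t' et']; apply/conj_stableP; exists (t * t').
by rewrite !(cSM nQ) -mulgA et' mulgA et mulgA.
Qed.
Canonical conj_stable_group a := Group (conj_stable_group_set a).

Lemma sub_conj_stable a : a \in AutF F Q -> Q \subset conj_stable a.
Proof.
move=> Fa; apply/subsetP=> u Qu; apply/conj_stableP; exists (ap a u).
by apply: (cS_inF nQ (AutF_inF Fa) (subxx Q)).
Qed.

Lemma rmul_realize_Aut a : a \in AutF F Q ->
  exists x, acts_as x a /\ exists2 k, inF F (conj_stable_group a) k
    & forall s, s \in conj_stable a -> rmul s * x = x * rmul (k s).
Proof.
move=> Fa; have sQN := sub_conj_stable Fa.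
have [s /conj_stableP //|k Fk ek] := saturated_extend satF nQ Fa sQN.
have [x xk] := rmul_realize Fk; exists x; split; last by exists k.
by move=> u Qu; rewrite xk ?ek // (subsetP sQN).
Qed.

(* The torsor is the set of left and right translates of realizations, one for each
   double coset of Aut_S(Q) in Aut_F(Q). *)
Lemma regular_torsor : exists X : finType, inhabited (torsor F Q X).
Proof.
have [|a c [s [t ->]]|a c d [s [t ->]] [s' [t' ->]]|b bR b_eq] :=
  @choose_representatives _ (fun a c => exists s t, c = cS s * a * cS t).
- by move=> a; exists 1, 1; rewrite cS1 mul1g mulg1.
- by exists s^-1, t^-1; rewrite !(cSV nQ) !mulgA mulVg mul1g mulgK.
- by exists (s' * s), (t * t'); rewrite !(cSM nQ) !mulgA.
have bb a : b (b a) = b a by apply/esym/b_eq/bR.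
have Fb a : a \in AutF F Q -> b a \in AutF F Q.
  by move=> Fa; have [s [t ->]] := bR a; rewrite !groupM //; apply: (AutS_Aut nQ).
have [|g gP] := @choice _ {perm S} (fun a x => a \in AutF F Q -> acts_as x a /\
    exists2 k, inF F (conj_stable_group a) k
    & forall s, s \in conj_stable a -> rmul s * x = x * rmul (k s)).
  move=> a; case: (boolP (a \in AutF F Q)) => [/rmul_realize_Aut[x xa] | _]; last by exists 1.
  by exists x.
pose Xs x := `[< exists a s t, [/\ a \in AutF F Q, b a = a & x = rmul s * g a * rmul t] >].
have Xs_l s x : Xs x -> Xs (rmul s * x).
  move=> /asboolP[a [s' [t [Fa ba ->]]]]; apply/asboolP.
  by exists a, (s * s'), t; split; rewrite // rmulM !mulgA.
have Xs_r s x : Xs x -> Xs (x * rmul s).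
  move=> /asboolP[a [s' [t [Fa ba ->]]]]; apply/asboolP.
  by exists a, s', (t * s); split; rewrite // rmulM !mulgA.
have Xs_acts x : Xs x -> exists a, a \in AutF F Q /\ acts_as x a.
  move=> /asboolP[a [s [t [Fa _ ->]]]]; have [xa _] := gP a Fa.
  exists (cS s * a * cS t); split; first by rewrite !groupM //; apply: (AutS_Aut nQ).
  by apply/acts_as_r/acts_as_l.
pose X : finType := {x : {perm S} | Xs x}.
have [tpX tpP] := choice (fun x : X => Xs_acts _ (valP x)).
pose lX s (x : X) : X := Sub (rmul s * val x) (Xs_l s _ (valP x)).
pose rX (x : X) s : X := Sub (val x * rmul s) (Xs_r s _ (valP x)).
have tpE (x : X) a : acts_as (val x) a -> tpX x = a.
  by apply: acts_as_eq; case: (tpP x).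
have tp_r (x : X) s : tpX (rX x s) = tpX x * cS s by apply/tpE/acts_as_r; case: (tpP x).
have tp_l s (x : X) : tpX (lX s x) = cS s * tpX x by apply/tpE/acts_as_l; case: (tpP x).
(* A coincidence in Aut_F(Q) lifts to Sym(S) up to Z(Q): [s] is in the domain of [k], and [k s] acts
   on [Q] as [s'] does. This makes the fibres single Z(Q)-orbits. *)
have stableE a s s' : a \in AutF F Q -> b a = a -> cS s * a = a * cS s' ->
  exists2 z, z \in Z & rmul s * g a = g a * rmul (s' * z).
  move=> Fa ba ess'; have [ga [k Fk gk]] := gP a Fa.
  have Ns : s \in conj_stable a by apply/conj_stableP; exists s'.
  have /(cS_eq cQ nQ)[z Zz ek] : cS s' = cS (k s).
    apply: (mulgI a); rewrite -ess'.
    apply: (acts_as_eq (x := rmul s * g a)); first exact: acts_as_l.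
    by rewrite gk //; apply: acts_as_r.
  by exists z; rewrite // gk ?ek.
exists X; constructor; apply: (@Torsor S F Q X lX rX tpX).
- by move=> x; apply: val_inj; rewrite /= rmul1 mul1g.
- by move=> s t x; apply: val_inj; rewrite /= rmulM mulgA.
- by move=> x; apply: val_inj; rewrite /= rmul1 mulg1.
- by move=> x s t; apply: val_inj; rewrite /= rmulM mulgA.
- by move=> s x t; apply: val_inj; rewrite /= mulgA.
- by move=> x; case: (tpP x).
- by [].
- by [].
- move=> a Fa; have [s [t def_ba]] := bR a; have [gb _] := gP _ (Fb a Fa).
  have Xg : Xs (g (b a)) by apply/asboolP; exists (b a), 1, 1; rewrite rmul1 mul1g mulg1 Fb.
  exists (lX s^-1 (rX (Sub _ Xg) t^-1)); rewrite tp_l tp_r (tpE _ (b a)) //.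
  by rewrite def_ba !(cSV nQ) !mulgA mulVg mul1g mulgK.
- case=> x Xx [y Xy] exy; have /asboolP[a [s [t [Fa ba def_x]]]] := Xx.
  have /asboolP[a' [s' [t' [Fa' ba' def_y]]]] := Xy.
  have [ga _] := gP a Fa; have [ga' _] := gP a' Fa'.
  have px : tpX (exist _ x Xx) = cS s * a * cS t.
    by apply: tpE; rewrite /= def_x; apply/acts_as_r/acts_as_l.
  have py : tpX (exist _ y Xy) = cS s' * a' * cS t'.
    by apply: tpE; rewrite /= def_y; apply/acts_as_r/acts_as_l.
  have e_xy : cS s' * a' * cS t' = cS s * a * cS t by rewrite -py -px exy.
  have eaa : a' = a.
    rewrite -ba -ba'; apply/esym/b_eq; exists (s'^-1 * s), (t * t'^-1).
    rewrite !(cSM nQ) !(cSV nQ); apply: (mulIg (cS t')); apply: (mulgI (cS s')).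
    by rewrite !mulgA mulgKV e_xy mulgV mul1g.
  subst a'; have ess' : cS (s'^-1 * s) * a = a * cS (t' * t^-1).
    rewrite !(cSM nQ) !(cSV nQ); apply: (mulIg (cS t)); apply: (mulgI (cS s')).
    by rewrite !mulgA mulgKV e_xy mulgV mul1g.
  have [z Zz ez] := stableE _ _ _ Fa ba ess'.
  have Zzt : z ^ t \in Z by rewrite memJ_norm // (subsetP (char_norms (center_char Q))) ?inNQ.
  exists (z ^ t)^-1; rewrite ?groupV //.
  apply: val_inj; rewrite /= rmulV; apply: (canRL (mulgK _)).
  have -> : x = rmul s' * (rmul (s'^-1 * s) * g a) * rmul t.
    by rewrite def_x mulgA -rmulM mulKVg.
  by rewrite ez def_y -!mulgA -!rmulM conjgE !mulgA.
- move=> x z Zz /(congr1 val) /= xz; apply: rmul_inj; apply: (mulgI (val x)).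
  by rewrite xz rmul1 mulg1.
- by move=> x u Qu; apply: val_inj; have [_ xa] := tpP x; apply: xa.
(* Moving [w] and [t] across shows that [psi] is conjugation by [w], then [k], then conjugation by
   [t]. *)
case=> x Xx P psi sQP xP; have /asboolP[a [w [t [Fa ba def_x]]]] := Xx.
have [ga [k Fk gk]] := gP a Fa.
have gP' s : s \in P -> rmul (s ^ w) * g a = g a * rmul (psi s ^ t^-1).
  move=> /xP/(congr1 val) /=; rewrite def_x => es.
  apply: (mulIg (rmul t)); apply: (mulgI (rmul w)).
  rewrite -!mulgA [rmul w * _]mulgA -!rmulM -conjgC conjgE invgK.
  by rewrite -!mulgA mulVg mulg1 !rmulM !mulgA -es !mulgA.
have Nw s : s \in P -> s ^ w \in conj_stable a.
  move=> Ps; apply/conj_stableP; exists (psi s ^ t^-1).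
  apply: (acts_as_eq (x := rmul (s ^ w) * g a)); first exact: acts_as_l.
  by rewrite gP' //; apply: acts_as_r.
have Fkw := inF_comp (inF_conj F P w) Fk Nw.
have := inF_comp (R := [set: S]%G) Fkw (inF_conj F _ t); move/(_ (fun s _ => in_setT _)).
apply: inF_eq => s Ps /=; have := gP' s Ps; rewrite gk ?Nw // => /mulgI/rmul_inj ->.
by rewrite conjgKV.
Qed.

End RegularBiset.

(** * A model as a torsor *)

Section Model.

Variables (p : nat) (S G : finGroupType) (e : sylow_embedding p S G).
Variables (F : fusion_system S) (FG : fusion_eq F (FSG e)).
Hypotheses (redG : p'_reduced p G) (conG : p_constrained p G).
Variable Q : {group S}.
Hypotheses (cQ : centric F Q) (nQ : fnormal F Q).
Implicit Types (P : {group S}) (x g : G).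

Local Notation i := (semb e).
Local Notation Z := 'Z(Q).
Local Notation injI := (@semb_injective p S G e).
Local Notation morI := (@sembM p S G e).

Lemma model_inF P f g : (forall s, s \in P -> i s ^ g = i (f s)) -> inF F P f.
Proof.
move=> gf; rewrite /inF FG inE; apply/existsP; exists g^-1.
by apply/forallP=> u; rewrite invgK ffunE subgK ?inE // gf ?subgP.
Qed.

Lemma model_realize P f : inF F P f -> exists g, forall s, s \in P -> i s ^ g = i (f s).
Proof.
rewrite /inF FG inE => /existsP[g /forallP gf]; exists g^-1 => s Ps.
by have /eqP := gf (subg P s); rewrite ffunE !subgK ?inE.
Qed.

Lemma conj_model P g : i @* P :^ g \subset i @* [set: S] ->
  exists f, forall s, s \in P -> i s ^ g = i (f s).
Proof.
move=> /subsetP sPg.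
have [|f fP] := @choice S S (fun s t => s \in P -> i s ^ g = i t); last by exists f.
move=> s; case: (boolP (s \in P)) => [Ps | _]; last by exists 1.
have /sPg/morphimP[t _ _ ->] : i s ^ g \in i @* P :^ g; last by exists t.
by rewrite memJ_conjg mem_morphim ?inE.
Qed.

(** Let [R] be the normal p-subgroup with C(R) <= R. Conjugation by [g] on [R] extends to a morphism
    that preserves [Q], realized by some [h] in N(Q). Then g h^-1 centralizes [R], so it lies in R
    <= S <= N(Q). *)
Lemma model_normal : i @* Q <| [set: G].
Proof.
have [R nRG /andP[pR cR]] := conG; have iI := semb_sylow e.
have sRS : R \subset i @* [set: S] by apply: (normal_sub_max_pgroup (Hall_max iI)).
pose R0 := (i @*^-1 R)%G; have iR0 : i @* R0 = R by rewrite morphpreK.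
rewrite /normal subsetT; apply/subsetP=> g _.
have nSQ : i @* [set: S] \subset 'N(i @* Q).
  by rewrite morphim_norms // (normal_norm nQ.1).
have NR : R :^ g = R by apply: (normsP (normal_norm nRG)); rewrite inE.
have [|f gf] := @conj_model R0 g; first by rewrite iR0 NR.
have [k [Fk ek Qk]] := inF_extend nQ (model_inF gf).
have [h hk] := model_realize Fk.
have Nh : h \in 'N(i @* Q).
  rewrite inE; apply/subsetP=> _ /imsetP[_ /morphimP[u _ Qu ->] ->].
  by rewrite hk ?(subsetP (joing_subr R0 Q)) // mem_morphim ?inE ?Qk.
rewrite -(mulgKV h g) groupM // (subsetP nSQ) // (subsetP sRS) // (subsetP cR) //.
apply/centP=> r; rewrite -iR0 => /morphimP[s _ Rs ->].
apply/commute_sym/commgP/conjg_fixP; rewrite conjgM gf // -ek // -hk ?conjgK //.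
exact: (subsetP (joing_subl R0 Q)).
Qed.

(** C(Q) is the product of Z(Q) with the p'-group O^p(C(Q)), which is normal in [G] because [Q] is,
    hence trivial. *)
Lemma model_cent : 'C(i @* Q) = i @* Z.
Proof.
have [defC p'K] := centric_Op FG cQ.
have nKG : Op_upper p 'C(i @* Q) <| [set: G].
  rewrite /normal subsetT; apply/subsetP=> g _; rewrite inE.
  apply: Op_upper_transporter; rewrite inE (normP _) // groupV.
  by rewrite (subsetP (normal_norm model_normal)) ?inE.
rewrite -defC (redG nKG p'K) mulg1.
by rewrite injm_center ?semb_inj ?subsetT.
Qed.

Lemma model_tp_ex x : exists2 a, a \in AutF F Q & {in Q, forall u, i (ap a u) = i u ^ x}.
Proof.
have NQ : x \in 'N(i @* Q) by rewrite (subsetP (normal_norm model_normal)) ?inE.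
have [|f xf] := @conj_model Q x; first by rewrite (normP NQ) morphimS ?subsetT.
have [|a Fa ea] := inF_AutF (model_inF xf); last by exists a => // u Qu; rewrite ea ?xf.
by move=> u Qu; rewrite -(mem_semb e) -xf // memJ_norm // mem_semb.
Qed.

Definition model_tp x : {perm subg_of Q} := s2val (cid2 (model_tp_ex x)).

Lemma model_tp_Aut x : model_tp x \in AutF F Q.
Proof. exact: (s2valP (cid2 (model_tp_ex x))). Qed.

Lemma model_tpE x u : u \in Q -> i (ap (model_tp x) u) = i u ^ x.
Proof. exact: (s2valP' (cid2 (model_tp_ex x))). Qed.

Lemma model_tp_eq x a : {in Q, forall u, i (ap a u) = i u ^ x} -> model_tp x = a.
Proof. by move=> ea; apply: ap_eq => u Qu; apply: injI; rewrite model_tpE // ea. Qed.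

Definition model_torsor : torsor F Q G.
Proof.
apply: (@Torsor S F Q G (fun s x => i s * x) (fun x s => x * i s) model_tp).
- by move=> x; rewrite morph1 mul1g.
- by move=> s t x; rewrite morI mulgA.
- by move=> x; rewrite morph1 mulg1.
- by move=> x s t; rewrite morI mulgA.
- by move=> s x t; rewrite mulgA.
- exact: model_tp_Aut.
- move=> s x; apply: model_tp_eq => u Qu; have NQ := norm_fnormal nQ s.
  by rewrite apM ap_cperm // model_tpE ?memJ_norm // morphJ ?inE // conjgM.
- move=> x s; apply: model_tp_eq => u Qu; have NQ := norm_fnormal nQ s.
  by rewrite apM ap_cperm ?ap_mem // morphJ ?inE // model_tpE // conjgM.
- move=> a Fa; have [x xa] := model_realize (AutF_inF Fa); exists x.
  by apply: model_tp_eq => u Qu; rewrite xa.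
- move=> x y exy; have : x^-1 * y \in 'C(i @* Q).
    apply/centP=> _ /morphimP[u _ Qu ->]; apply/commute_sym/commgP/conjg_fixP.
    have Qv := ap_mem (model_tp x)^-1 u; rewrite -{1}(apKV (model_tp x) Qu) model_tpE //.
    by rewrite -conjgM mulKVg -model_tpE // -exy apKV.
  by rewrite model_cent => /morphimP[z _ Zz xyz]; exists z; rewrite // -xyz mulKVg.
- by move=> x z _ xz; apply: injI; apply: (mulgI x); rewrite xz morph1 mulg1.
- by move=> x u Qu; rewrite model_tpE // -conjgC.
move=> x P psi sQP xP; apply: (@model_inF P psi x) => s Ps.
by apply: (mulgI x); rewrite -conjgC xP.
Defined.

End Model.

(** A multiplication compatible with both translations by [S]; this treats a model and Aut_L(Q)
    alike. *)
Record torsor_mul (S : finGroupType) (F : fusion_system S) (Q : {group S}) (X : Type)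
    (T : torsor F Q X) := TorsorMul {
  tm :> X -> X -> X;
  tmA : forall x y z, tm x (tm y z) = tm (tm x y) z;
  tp_tm : forall x y, tp T (tm x y) = tp T x * tp T y;
  tm_tl : forall s x y, tm (tl T s x) y = tl T s (tm x y);
  tm_tr : forall x y s, tm x (tr T y s) = tr T (tm x y) s;
  tm_trl : forall x s y, tm (tr T x s) y = tm x (tl T s y)
}.

(** * Multiplicative biset maps *)

Section Averaging.

Variables (p : nat) (S : finGroupType) (F : fusion_system S) (Q : {group S}).
Hypotheses (pS : p.-group [set: S]) (satF : saturated F p).
Hypotheses (cQ : centric F Q) (nQ : fnormal F Q).
Local Notation Z := 'Z(Q).
Local Notation abelZ := (center_abelian Q).

Variables (X : finType) (T : torsor F Q X).

Variable rep : X -> X.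
Hypotheses (repP : forall x, exists s, rep x = tl T s x).
Hypothesis (rep_l : forall s x, rep (tl T s x) = rep x).
Local Notation Y := [pred x | rep x == x].

(** The mean of [h] over S\X: the exponent inverts the number of orbits modulo |Z(Q)|. *)
Definition avg (h : X -> S) : S := aprod abelZ Y h ^+ expg_invn Z #|Y|.

Lemma avg_mem h : avg h \in Z.
Proof. by rewrite groupX // aprod_mem. Qed.

Lemma eq_avg h k : h =1 k -> avg h = avg k.
Proof. by move=> ehk; rewrite /avg (eq_aprod _ _ ehk). Qed.

Lemma avgM h k : (forall x, h x \in Z) -> (forall x, k x \in Z) ->
  avg (fun x => h x * k x) = avg h * avg k.
Proof.
move=> Zh Zk; rewrite /avg aprodM // expgMn //.
by apply: (centsP abelZ); apply: aprod_mem.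
Qed.

Lemma avg_const z : z \in Z -> avg (fun=> z) = z.
Proof.
move=> Zz; rewrite /avg aprod_const //.
by rewrite (expgK (G := 'Z(Q)) (coprime_orbits pS satF nQ repP rep_l)).
Qed.

Lemma avg_morph P f h : inF F P f -> Q \subset P -> (forall x, h x \in Z) ->
  avg (fun x => f (h x)) = f (avg h).
Proof.
move=> Ff sQP Zh; have sZP := subset_trans (center_sub Q) sQP.
have fM : {in Z &, {morph f : x y / x * y}}.
  by move=> x y Zx Zy; rewrite (inF_M Ff) ?(subsetP sZP).
have fZ := fnormal_center cQ nQ Ff sQP.
rewrite /avg aprod_morph //; elim: expg_invn => [|n IHn]; first by rewrite (inF_1 Ff).
by rewrite !expgS IHn fM ?groupX ?aprod_mem.
Qed.

Lemma avg_equivariant (e : X -> X) h : injective e ->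
    (forall s x, e (tl T s x) = tl T s (e x)) -> (forall s x, h (tl T s x) = h x) ->
  avg (fun x => h (e x)) = avg h.
Proof. by move=> inj_e el hl; rewrite /avg (aprod_equivariant repP rep_l). Qed.

Variables (m : torsor_mul T) (X' : Type) (T' : torsor F Q X') (m' : torsor_mul T').
Hypothesis mI : forall x, injective (m^~ x).

Lemma torsor_mul_map : exists theta : X -> X',
  [/\ forall x y, theta (m x y) = m' (theta x) (theta y),
      forall x, tp T' (theta x) = tp T x
    & forall s x, theta (tl T s x) = tl T' s (theta x)].
Proof.
have id1 : {in Q, ap (1 : {perm subg_of Q}) =1 id} by apply: ap1.
have [f [fp fl fr]] :=
  biset_map pS satF cQ nQ T T' (inF_id F [set: S]%G) (subsetT Q) (group1 _) id1.
have {}fp x : tp T' (f x) = tp T x by rewrite fp mulg1.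
have {}fr x s : f (tr T x s) = tr T' (f x) s by rewrite fr ?inE.
have zeta_ex (xg : X * X) : exists z, z \in Z /\
    f (m xg.1 xg.2) = tr T' (m' (f xg.1) (f xg.2)) z.
  case: xg => x g /=; have : tp T' (m' (f x) (f g)) = tp T' (f (m x g)).
    by rewrite fp !tp_tm !fp.
  by case/(@tp_inj _ _ _ _ T')=> z Zz ez; exists z.
have [zeta0 zeta0P] := choice zeta_ex; pose zeta g x := zeta0 (x, g).
have Zzeta g x : zeta g x \in Z by case: (zeta0P (x, g)).
have zetaE g x : f (m x g) = tr T' (m' (f x) (f g)) (zeta g x) by case: (zeta0P (x, g)).
have zeta_eq g x z : f (m x g) = tr T' (m' (f x) (f g)) z -> zeta g x = z.
  by rewrite zetaE; apply: tr_inj.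
have zeta_l g s x : zeta g (tl T s x) = zeta g x.
  by apply: zeta_eq; rewrite tm_tl !fl zetaE tm_tl tlr.
have sZQ := subsetP (center_sub Q).
exists (fun g => tr T' (f g) (avg (zeta g))); split=> [g h | g | s g].
- pose b := ap (tp T h); have Fb : inF F Q b by apply: AutF_inF (tp_Aut T h).
  have Zb := fnormal_center cQ nQ Fb (subxx Q).
  pose c := zeta h g; have Zc : c \in Z := Zzeta h g.
  (* The cocycle identity, from computing the image of the triple product x g h in two ways.
     Averaged over [x], with right multiplication by [g] permuting the left orbits, it says that the
     corrected map is multiplicative. *)
  have czeta x : c * zeta (m g h) x = b (zeta g x) * zeta h (m x g).
    apply: (@tr_inj _ _ _ cQ nQ _ T' (m' (f x) (m' (f g) (f h)))).
    rewrite !trM -tm_tr -zetaE -zetaE tmA zetaE zetaE tm_trl tl_Q ?sZQ //.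
    by rewrite tm_tr tmA fp.
  have eAvg : c * avg (zeta (m g h)) = b (avg (zeta g)) * avg (zeta h).
    have -> : c * avg (zeta (m g h)) = avg (fun x => c * zeta (m g h) x).
      by rewrite avgM // avg_const.
    rewrite -(avg_morph Fb) // (eq_avg czeta) avgM //; last by move=> x; apply: Zb.
    congr (_ * _); apply: (avg_equivariant (e := fun x => m x g)) => //.
    by move=> s x; rewrite tm_tl.
  rewrite zetaE -/c -trM eAvg trM tm_trl tlr tm_tr tl_Q ?sZQ ?avg_mem // fp.
  by rewrite tm_tr.
- by rewrite (tp_cent cQ nQ) ?avg_mem.
rewrite fl -tlr; congr (tl _ _ (tr _ _ _)).
(* The defect of s g at [x] is that of [g] at x s, and the mean is invariant under right
   translation. *)
rewrite -[RHS](avg_equivariant (e := fun x => tr T x s)) //.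
- apply: eq_avg => x; apply: zeta_eq.
  by rewrite -tm_trl zetaE fl fr tm_trl.
- by move=> x y /(congr1 (fun w => tr T w s^-1)); rewrite !trK.
by move=> t x; rewrite tlr.
Qed.

End Averaging.

(** * Aut_L(Q) as a torsor *)

Section Linking.

Variables (p : nat) (S : finGroupType) (F : fusion_system S) (L : linking_system F).
Implicit Types (P R T : cobj F).

Local Notation "g \oL f" := (@ccomp _ L _ _ _ g f) (at level 50, left associativity).

Definition lact P R (f : mor L P R) (x : S) : S :=
  sgval (val (fmap (lpi L) f) (subg (val P) x)).

Definition ldel P (x : S) : mor L P P := ldelta L (subg (val P) x).

Lemma lact_inF P R (f : mor L P R) : inF F (val P) (lact f).
Proof. exact: fhom_inF (valP (fmap (lpi L) f)). Qed.

Lemma lact_mem P R (f : mor L P R) x : lact f x \in val R.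
Proof. exact: subgP. Qed.

Lemma lact_comp P R T (g : mor L R T) (f : mor L P R) x :
  lact (g \oL f) x = lact g (lact f x).
Proof. by rewrite /lact fmap_comp /= ffunE sgvalK. Qed.

Lemma lact_cid P : {in val P, lact (Defs.cid L P) =1 id}.
Proof. by move=> x Px; rewrite /lact fmap_id /= ffunE subgK. Qed.

Lemma lact_ldel P x u : x \in val P -> u \in val P -> lact (ldel P x) u = u ^ x^-1.
Proof. by move=> Px Pu; rewrite /lact /ldel lpi_delta /= !subgK. Qed.

Lemma lact_eqP P R (f g : mor L P R) : {in val P, lact f =1 lact g} ->
  fmap (lpi L) f = fmap (lpi L) g.
Proof.
move=> efg; apply: val_inj; apply/ffunP=> u; apply: subg_inj.
by have := efg (sgval u) (subgP u); rewrite /lact sgvalK.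
Qed.

Lemma lact_eq P R (f g : mor L P R) : {in val P, lact f =1 lact g} ->
  exists2 z, z \in 'Z(val P) & g = f \oL ldel P z.
Proof.
move/lact_eqP/lpi_orbit=> [z Zz ->]; exists (sgval z) => //.
by rewrite /ldel sgvalK.
Qed.

Lemma ldel1 P : ldel P 1 = Defs.cid L P.
Proof. by rewrite /ldel morph1 ldelta1. Qed.

Lemma ldelM P : {in val P &, forall x y, ldel P (x * y) = ldel P x \oL ldel P y}.
Proof. by move=> x y Px Py; rewrite /ldel morphM // ldeltaM. Qed.

Lemma ldel_natural P R (f : mor L P R) x : x \in val P ->
  f \oL ldel P x = ldel R (lact f x) \oL f.
Proof. by move=> Px; rewrite /ldel lcompC /lact sgvalK. Qed.

Lemma ldel_free P R (f : mor L P R) z : z \in 'Z(val P) -> f \oL ldel P z = f -> z = 1.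
Proof.
move=> Zz ef; have Pz : z \in val P by case/setIP: Zz.
have := lZ_free (f := f) (z := subg (val P) z); rewrite subgK // => /(_ Zz ef).
by move/(congr1 (@sgval _ (val P))); rewrite subgK.
Qed.

Lemma lift_inF P R k : inF F (val P) k -> {in val P, forall x, k x \in val R} ->
  exists f : mor L P R, {in val P, lact f =1 k}.
Proof.
move=> Fk kR; pose phi : val P ~> val R := [ffun u => subg (val R) (k (sgval u))].
have Fphi : phi \in fhom F (val P) (val R).
  by apply: (inF_fhom Fk) => u; rewrite ffunE subgK ?kR ?subgP.
have [f ef] := @lpi_surj _ _ L P R (exist _ phi Fphi : mor (Fc F) P R); exists f => x Px.
by rewrite /lact ef /= ffunE !subgK ?kR.
Qed.

(** Injectivity of [lact g] makes [f] and [f'] equal in [F], so they differ by Z(P), which acts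
    freely on the composite with [g]. *)
Lemma lmono P R T (g : mor L R T) (f f' : mor L P R) : g \oL f = g \oL f' -> f = f'.
Proof.
move=> egf; have [x Px|z Zz def_f'] := @lact_eq _ _ f f'.
  apply: (inF_inj (lact_inF g)); rewrite ?lact_mem // -!lact_comp.
  by rewrite egf.
move: egf; rewrite def_f' ccompA => /esym/(ldel_free Zz) ->.
by rewrite ldel1 ccompf1.
Qed.

Lemma lfactor P R T (g : mor L R T) (h : mor L P T) k :
    inF F (val P) k -> {in val P, forall x, k x \in val R} ->
    {in val P, forall x, lact g (k x) = lact h x} ->
  exists2 f : mor L P R, g \oL f = h & {in val P, lact f =1 k}.
Proof.
move=> Fk kR ekh; have [f0 ef0] := lift_inF Fk kR.
have [x Px|z Zz def_h] := @lact_eq _ _ (g \oL f0) h.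
  by rewrite lact_comp ef0 // ekh.
have [Pz Cz] := setIP Zz; exists (f0 \oL ldel P z); first by rewrite ccompA -def_h.
move=> x Px; rewrite lact_comp lact_ldel // ef0 ?memJ_norm ?groupV ?(subsetP (normG _)) //.
by congr k; apply/conjg_fixP/commgP; apply: commute_sym; apply: (centP (groupVr Cz)).
Qed.

(** If [w] fixes [f] on the left, it centralizes f(P), hence is f(z) with [z] in Z(P) because [P] is
    centric; naturality moves [z] to the right, where the action is free. *)
Lemma ldel_free_l P R (f : mor L P R) : {in val R &, injective (fun x => ldel R x \oL f)}.
Proof.
move=> x y Rx Ry exy; pose w := x^-1 * y; have Rw : w \in val R by rewrite groupM ?groupV.
have wf : ldel R w \oL f = f.
  by rewrite ldelM ?groupV // -ccompA -exy ccompA -ldelM ?groupV // mulVg ldel1 ccomp1f.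
pose P' := Group (inF_group_set (lact_inF f)).
have /eqP cP' := implyP (forallP (valP P) P') (inF_fconj (R := P') (lact_inF f) erefl).
have : w \in 'C(P').
  rewrite -groupV; apply/centP=> _ /imsetP[u Pu ->]; apply/commute_sym/commgP/conjg_fixP.
  by rewrite -(lact_ldel (P := R)) ?lact_mem // -lact_comp wf.
rewrite cP' => /setIP[/imsetP[z Pz def_w] Cw].
have Zz : z \in 'Z(val P).
  rewrite inE Pz; apply/centP=> u Pu; apply: (inF_inj (lact_inF f)); rewrite ?groupM //.
  by rewrite !(inF_M (lact_inF f)) // -def_w; apply: (centP Cw); apply: imset_f.
have z1 : z = 1 by apply: (ldel_free (f := f) Zz); rewrite ldel_natural // -def_w.
by apply/eqP; rewrite eq_mulVg1 -/w def_w z1 (inF_1 (lact_inF f)).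
Qed.

Variable Q : cobj F.
Hypotheses (pS : p.-group [set: S]) (satF : saturated F p) (nQ : fnormal F (val Q)).

Local Notation cQ := (valP Q).
Local Notation Z := 'Z(val Q).
Local Notation cS := (cperm (val Q)).
Local Notation inNQ := (norm_fnormal nQ).

Definition ctop : cobj F := exist _ [set: S]%G (centric_overgroup cQ nQ (subsetT (val Q))).
Local Notation St := ctop.

Lemma lincl_ex P : exists2 f : mor L P St, True & {in val P, lact f =1 id}.
Proof. have [|f ef] := @lift_inF P St id (inF_id F (val P)); first by move=> x; rewrite inE.
by exists f.
Qed.

(** Any lift of the inclusion will do. Since morphisms are monomorphisms, an inclusion [j] of [Q] in
    [P] is then determined by [lincl P \oL j = lincl Q]. *)
Definition lincl P : mor L P St := s2val (cid2 (lincl_ex P)).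

Lemma lact_lincl P : {in val P, lact (lincl P) =1 id}.
Proof. exact: (s2valP' (cid2 (lincl_ex P))). Qed.

Lemma lrestrict P R (h : mor L P St) : {in val P, forall x, lact h x \in val R} ->
  exists2 f : mor L P R, lincl R \oL f = h & {in val P, lact f =1 lact h}.
Proof.
move=> hR; apply: (lfactor (lact_inF h) hR) => x Px.
by rewrite lact_lincl ?hR.
Qed.

Lemma lact_restrict P R (f : mor L P R) : {in val P, lact (lincl R \oL f) =1 lact f}.
Proof. by move=> x Px; rewrite lact_comp lact_lincl ?lact_mem. Qed.

Lemma ltopN s : s \in val St. Proof. by rewrite inE. Qed.

Lemma lext_ex s : exists2 h : mor L Q Q, lincl Q \oL h = ldel St s \oL lincl Q &
  {in val Q, lact h =1 fun u => u ^ s^-1}.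
Proof.
have sE : {in val Q, lact (ldel St s \oL lincl Q) =1 fun u => u ^ s^-1}.
  by move=> u Qu; rewrite lact_comp lact_lincl // lact_ldel ?ltopN.
have [|f ef1 ef2] := @lrestrict Q Q (ldel St s \oL lincl Q).
  by move=> u Qu; rewrite sE // memJ_norm ?inNQ.
by exists f => // u Qu; rewrite ef2 // sE.
Qed.

(* The image of s : S under S -> Aut_L(S) -> Aut_L(Q). *)
Definition lext s : mor L Q Q := s2val (cid2 (lext_ex s)).

Lemma lextE s : lincl Q \oL lext s = ldel St s \oL lincl Q.
Proof. exact: (s2valP (cid2 (lext_ex s))). Qed.

Lemma lact_lext s : {in val Q, lact (lext s) =1 fun u => u ^ s^-1}.
Proof. exact: (s2valP' (cid2 (lext_ex s))). Qed.

Lemma lextM s t : lext (s * t) = lext s \oL lext t.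
Proof.
apply: (@lmono _ _ _ (lincl Q)); rewrite lextE ldelM ?ltopN // ccompA lextE.
by rewrite -!ccompA lextE.
Qed.

Lemma lext1 : lext 1 = Defs.cid L Q.
Proof.
by apply: (@lmono _ _ _ (lincl Q)); rewrite lextE ldel1 ccomp1f ccompf1.
Qed.

Lemma lext_Q u : u \in val Q -> lext u = ldel Q u.
Proof.
move=> Qu; apply: (@lmono _ _ _ (lincl Q)); rewrite lextE ldel_natural //.
by rewrite lact_lincl.
Qed.

Lemma ltp_ex (h : mor L Q Q) : exists2 a, a \in AutF F (val Q) & {in val Q, ap a =1 lact h}.
Proof. by apply: inF_AutF (lact_inF h) _ => u _; apply: lact_mem. Qed.

Definition ltp h : {perm subg_of (val Q)} := s2val (cid2 (ltp_ex h)).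

Lemma ltp_Aut h : ltp h \in AutF F (val Q).
Proof. exact: (s2valP (cid2 (ltp_ex h))). Qed.

Lemma ltpE h : {in val Q, ap (ltp h) =1 lact h}.
Proof. exact: (s2valP' (cid2 (ltp_ex h))). Qed.

Lemma ltp_eq h a : {in val Q, lact h =1 ap a} -> ltp h = a.
Proof. by move=> ea; apply: ap_eq => u Qu; rewrite ltpE // ea. Qed.

Lemma ltp_lact h k : ltp h = ltp k -> {in val Q, lact h =1 lact k}.
Proof. by move=> ehk u Qu; rewrite -!ltpE // ehk. Qed.

(** An arbitrary lift of [k] restricts to [h] up to some [z] in Z(Q), which naturality turns into a
    correction by [ldel P z]. *)
Lemma lextend P (h : mor L Q Q) k : val Q \subset val P -> inF F (val P) k ->
    {in val Q, k =1 lact h} -> forall j : mor L Q P, lincl P \oL j = lincl Q ->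
  exists h' : mor L P St, h' \oL j = lincl Q \oL h.
Proof.
move=> sQP Fk ek j ej; have [|h0 eh0] := @lift_inF P St k Fk; first by move=> x; rewrite inE.
have jE : {in val Q, lact j =1 id}.
  by move=> u Qu; rewrite -lact_restrict // ej lact_lincl.
have [u Qu|z Zz ez] := @lact_eq _ _ (h0 \oL j) (lincl Q \oL h).
  by rewrite lact_comp jE // eh0 ?(subsetP sQP) // lact_restrict // ek.
have [Qz _] := setIP Zz.
by exists (h0 \oL ldel P z); rewrite ez -!ccompA ldel_natural // jE.
Qed.

Lemma lext_free (h : mor L Q Q) s t : lext s \oL h = lext t \oL h -> s = t.
Proof.
move=> est; apply: (ldel_free_l (f := lincl Q \oL h)); rewrite ?ltopN //.
by rewrite !ccompA -!lextE -!ccompA est.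
Qed.

Lemma lext_incl P (j : mor L Q P) s : lincl P \oL j = lincl Q -> s \in val P ->
  j \oL lext s = ldel P s \oL j.
Proof.
move=> ej Ps; apply: (@lmono _ _ _ (lincl P)).
by rewrite ccompA ej lextE -ej !ccompA ldel_natural // lact_lincl.
Qed.

Lemma lincl_sub P : val Q \subset val P ->
  exists2 j : mor L Q P, lincl P \oL j = lincl Q & {in val Q, lact j =1 id}.
Proof.
move=> sQP; have [|j ej jE] := @lrestrict Q P (lincl Q).
  by move=> u Qu; rewrite lact_lincl ?(subsetP sQP).
by exists j => // u Qu; rewrite jE // lact_lincl.
Qed.

Lemma ltp_l s h : ltp (h \oL lext s^-1) = cS s * ltp h.
Proof.
apply: ltp_eq => u Qu; have NQ := inNQ s.
by rewrite lact_comp lact_lext // invgK apM ap_cperm // ltpE ?memJ_norm.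
Qed.

Lemma ltp_r h s : ltp (lext s^-1 \oL h) = ltp h * cS s.
Proof.
apply: ltp_eq => u Qu; have NQ := inNQ s.
by rewrite lact_comp lact_lext ?lact_mem // invgK apM ap_cperm ?ap_mem // ltpE.
Qed.

(** In [L] conjugation is on the left, in torsors on the right: hence the inverses, and [S] acting
    on the left by precomposition. *)
Definition linking_torsor : torsor F (val Q) (mor L Q Q).
Proof.
apply: (@Torsor S F (val Q) (mor L Q Q) (fun s h => h \oL lext s^-1)
  (fun h s => lext s^-1 \oL h) ltp).
- by move=> h; rewrite invg1 lext1 ccompf1.
- by move=> s t h; rewrite invMg lextM ccompA.
- by move=> h; rewrite invg1 lext1 ccomp1f.
- by move=> h s t; rewrite invMg lextM -ccompA.
- by move=> s h t; rewrite ccompA.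
- exact: ltp_Aut.
- by move=> s h; apply: ltp_l.
- by move=> h s; apply: ltp_r.
- move=> a Fa; have [h eh] := lift_inF (P := Q) (R := Q) (AutF_inF Fa) (fun u _ => ap_mem a u).
  by exists h; apply: ltp_eq.
- move=> h k /ltp_lact/lact_eq[z Zz ->]; have [Qz _] := setIP Zz.
  have fZ := fnormal_center cQ nQ (lact_inF h) (subxx _).
  exists (lact h z)^-1; rewrite ?groupV ?fZ // invgK lext_Q ?lact_mem //.
  exact: ldel_natural.
- move=> h z Zz; have [Qz _] := setIP Zz; rewrite lext_Q ?groupV // => zh.
  apply/eqP; rewrite -invg_eq1; apply/eqP.
  by apply: (ldel_free_l (f := h)); rewrite ?groupV // zh ldel1 ccomp1f.
- move=> h u Qu; rewrite !lext_Q ?groupV ?ap_mem // ldel_natural ?groupV //.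
  by rewrite (inF_V (lact_inF h)) // ltpE.
(* By saturation the action of [h] on [Q] extends to [P], hence [h] extends to some [h'] in [L].
   Freeness of [S] on endomorphisms of [Q] identifies [psi] with [lact h']. *)
move=> h P psi sQP hP; pose Pc : cobj F := exist _ P (centric_overgroup cQ nQ sQP).
have [|k Fk ek] := saturated_extend satF nQ (ltp_Aut h) sQP.
  by move=> s Ps; exists (psi s); rewrite -ltp_l hP // ltp_r.
have [j ej jE] := lincl_sub (P := Pc) sQP.
have [|h' eh'] := @lextend Pc h k sQP Fk _ j ej.
  by move=> u Qu; rewrite ek // ltpE.
apply: inF_eq (lact_inF h') => s Ps /=; apply: invg_inj.
rewrite -(inF_V (lact_inF h')) //; apply: (@lext_free h); apply: (@lmono _ _ _ (lincl Q)).
rewrite -hP // ccompA lextE -ccompA -eh' [in RHS]ccompA -eh' -[in RHS]ccompA.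
by rewrite (lext_incl ej) ?groupV // ccompA -ldel_natural ?groupV // ccompA.
Defined.

End Linking.

(** [Phi] induces the identity on Hom_F(P,R) and is Z(P)-equivariant on the fibres, which are free
    orbits on both sides. *)
Lemma linking_functor_bij (S : finGroupType) (F : fusion_system S)
    (L L' : linking_system F) (Phi : functor L L') :
    (forall P R (f : mor L P R), fmap (lpi L') (fmap Phi f) = fmap (lpi L) f) ->
    (forall P (x : subg_of (val P)), fmap Phi (ldelta L x) = ldelta L' x) ->
  linking_iso L L'.
Proof.
move=> Phi_pi Phi_delta; exists Phi; split=> // P R.
have surj (c : mor L' P R) : exists f, fmap Phi f = c.
  have [f ef] := lpi_surj L (fmap (lpi L') c).
  have /lpi_orbit[z Zz ->] : fmap (lpi L') (fmap Phi f) = fmap (lpi L') c by rewrite Phi_pi.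
  by exists (ccomp f (ldelta L z)); rewrite fmap_comp Phi_delta.
exists (fun c => projT1 (cid (surj c))) => [f | c]; last by case: cid.
case: cid => g /= egf; have /lpi_orbit[z Zz def_f] : fmap (lpi L) g = fmap (lpi L) f.
  by rewrite -!Phi_pi egf.
rewrite def_f fmap_comp Phi_delta in egf.
by rewrite def_f (lZ_free Zz (esym egf)) ldelta1 ccompf1.
Qed.

(** * Comparison of a model with a linking system *)

Section ModelLinking.

Variables (p : nat) (S G : finGroupType) (e : sylow_embedding p S G).
Variables (F : fusion_system S) (FG : fusion_eq F (FSG e)).
Hypotheses (pS : p.-group [set: S]) (satF : saturated F p).
Hypotheses (redG : p'_reduced p G) (conG : p_constrained p G).
Variables (L : linking_system F) (Q : cobj F).
Hypothesis nQ : fnormal F (val Q).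

Local Notation i := (semb e).
Local Notation cQ := (valP Q).
Local Notation injI := (@semb_injective p S G e).
Local Notation morI := (@sembM p S G e).
Local Notation "g \oL f" := (@ccomp _ L _ _ _ g f) (at level 50, left associativity).
Local Notation lextQ := (lext L nQ).

Let TG := model_torsor FG redG conG cQ nQ.
Let TL := linking_torsor L satF nQ.

Definition model_mul : torsor_mul TG.
Proof.
apply: (@TorsorMul S F (val Q) G TG mulg).
- exact: mulgA.
- by move=> x y; apply: model_tp_eq => u Qu; rewrite apM !model_tpE ?ap_mem // conjgM.
- by move=> s x y; rewrite /= mulgA.
- by move=> x y s; rewrite /= mulgA.
by move=> x s y; rewrite /= mulgA.
Defined.

Definition linking_mul : torsor_mul TL.
Proof.
apply: (@TorsorMul S F (val Q) _ TL (fun h k => k \oL h)).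
- by move=> x y z; rewrite ccompA.
- by move=> h k; apply: ltp_eq => u Qu; rewrite lact_comp apM ltpE ?ap_mem // ltpE.
- by move=> s x y; rewrite /= ccompA.
- by move=> x y s; rewrite /= ccompA.
by move=> x s y; rewrite /= ccompA.
Defined.

Lemma model_linking_map : exists phi : G -> mor L Q Q,
  [/\ forall x y, phi (x * y) = phi x \oL phi y,
      forall s, phi (i s) = lextQ s,
      injective phi & forall f, exists x, phi x = f].
Proof.
have [rep [repP rep_l]] := orbit_representatives TG.
have mI x : injective (model_mul^~ x) by apply: mulIg.
have [theta [tM tpE tl_]] := torsor_mul_map pS satF cQ nQ repP rep_l linking_mul mI.
have {}tM x y : theta (x * y) = theta y \oL theta x := tM x y.
have {}tl_ s x : theta (i s * x) = theta x \oL lextQ s^-1 := tl_ s x.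
have t1 : theta 1 = Defs.cid L Q.
  by apply: (@lmono _ _ _ _ _ _ (theta 1)); rewrite -tM mulg1 ccompf1.
have ti s : theta (i s) = lextQ s^-1 by rewrite -(mulg1 (i s)) tl_ t1 ccomp1f.
have t_inj : injective theta.
  move=> x y exy; have : tp TG x = tp TG y by rewrite -!tpE exy.
  case/(@tp_inj _ _ _ _ TG)=> z Zz def_y; have {}def_y : y = x * i z := def_y.
  move: exy; rewrite def_y tM ti -{1}(ccomp1f (theta x)).
  rewrite -(lext1 L nQ) => /lext_free/esym/eqP; rewrite invg_eq1 => /eqP->.
  by rewrite morph1 mulg1.
(* The product of [linking_mul] is composition in reverse order; inverting the argument restores
   it. *)
exists (fun x => theta x^-1); split=> [x y | s | x y /t_inj/invg_inj | f] //.
- by rewrite invMg tM.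
- by rewrite -morphV ?inE // ti invgK.
have [x tpx] := tp_surj TG (tp_Aut TL f).
have : tp TL (theta x) = tp TL f by rewrite tpE.
case/(@tp_inj _ _ _ _ TL)=> z _ def_f; exists (x * i z)^-1.
by rewrite invgK tM ti def_f.
Qed.

Lemma model_isog_Aut : isog_Aut G L Q.
Proof.
have [phi [phiM phi_i phi_inj phi_surj]] := model_linking_map.
have phi1 : phi 1 = Defs.cid L Q by rewrite -(morph1 i) phi_i lext1.
exists phi; split=> // f; split=> [_ // | [x <-]].
by exists (phi x^-1); rewrite -!phiM mulVg mulgV phi1.
Qed.

Variable phi : G -> mor L Q Q.
Hypotheses (phiM : forall x y, phi (x * y) = phi x \oL phi y).
Hypotheses (phi_i : forall s, phi (i s) = lextQ s) (phi_inj : injective phi).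

Let phi1 : phi 1 = Defs.cid L Q.
Proof. by rewrite -(morph1 i) phi_i lext1. Qed.

Local Notation incl := (lincl L nQ).
Local Notation St := (ctop nQ).

Definition chull (P : cobj F) : cobj F :=
  exist _ (val P <*> val Q)%G (centric_overgroup cQ nQ (joing_subr (val P) (val Q))).

(* f is the restriction to P of the extension to PQ of phi x : Q -> Q. *)
Definition lrel (P R : cobj F) (f : mor L P R) (x : G) : Prop :=
  exists (h : mor L (chull P) St) (j : mor L Q (chull P)) (k : mor L P (chull P)),
    [/\ incl (chull P) \oL j = incl Q, incl (chull P) \oL k = incl P,
        h \oL j = incl Q \oL phi x & incl R \oL f = h \oL k].

Implicit Types P R T : cobj F.

(** Naturality in [L] gives the commutation of [x] with [i s] after applying [phi] and the
    monomorphism [incl Q]; injectivity of [phi] brings it back to [G]. *)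
Lemma lact_extension P (h : mor L P St) (j : mor L Q P) x s :
    incl P \oL j = incl Q -> h \oL j = incl Q \oL phi x -> s \in val P ->
  i (lact h s) = i s ^ x^-1.
Proof.
move=> ej ehj Ps; have : x * i s = i (lact h s) * x.
  apply: phi_inj; apply: (@lmono _ _ _ _ _ _ (incl Q)).
  rewrite !phiM !phi_i ccompA -ehj -ccompA (lext_incl ej) // ccompA ldel_natural //.
  by rewrite -ccompA ehj ccompA -lextE ccompA.
by rewrite conjgE invgK mulgA => ->; rewrite mulgK.
Qed.

Lemma extension_uniq P (h h' : mor L P St) (j : mor L Q P) x :
    incl P \oL j = incl Q ->
    h \oL j = incl Q \oL phi x -> h' \oL j = incl Q \oL phi x -> h = h'.
Proof.
move=> ej eh eh'; have [s Ps|z Zz def_h'] := @lact_eq _ _ _ _ _ h h'.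
  by apply: injI; rewrite (lact_extension ej eh) // (lact_extension ej eh').
have [Pz _] := setIP Zz; rewrite def_h' -ccompA -(lext_incl ej) // ccompA eh in eh'.
have : phi (x * i z) = phi (x * 1).
  by apply: (@lmono _ _ _ _ _ _ (incl Q)); rewrite mulg1 phiM phi_i ccompA.
move/phi_inj/mulgI; rewrite -(morph1 i) => /injI z1.
by rewrite def_h' z1 ldel1 ccompf1.
Qed.

Lemma chull_incl P : exists (j : mor L Q (chull P)) (k : mor L P (chull P)),
  [/\ incl (chull P) \oL j = incl Q, incl (chull P) \oL k = incl P
     & {in val P, lact k =1 id}].
Proof.
have [j ej _] := lincl_sub L nQ (P := chull P) (joing_subr (val P) (val Q)).
have sPH := subsetP (joing_subl (val P) (val Q)).
have [|k ek kE] := @lrestrict _ _ _ _ nQ P (chull P) (incl P).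
  by move=> u Pu; rewrite lact_lincl ?sPH.
by exists j, k; split=> // u Pu; rewrite kE ?lact_lincl.
Qed.

Lemma lrel_lact P R (f : mor L P R) x s : lrel f x -> s \in val P ->
  i (lact f s) = i s ^ x^-1.
Proof.
move=> [h [j [k [ej ek ehj efk]]]] Ps.
have [_ [k' [_ ek' k'E]]] := chull_incl P.
have ekk : k = k' by apply: (@lmono _ _ _ _ _ _ (incl (chull P))); rewrite ek.
rewrite -(lact_restrict nQ f Ps) efk lact_comp (lact_extension ej ehj) ?lact_mem //.
by rewrite ekk k'E.
Qed.

Lemma lrel_transporter P R (f : mor L P R) x : lrel f x ->
  x \in transporter (i @* val P) (i @* val R).
Proof.
move=> fx; rewrite inE; apply/subsetP=> _ /imsetP[_ /morphimP[s _ Ps ->] ->].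
by rewrite -(lrel_lact fx) // mem_semb lact_mem.
Qed.

Lemma lrel_uniq P R (f f' : mor L P R) x : lrel f x -> lrel f' x -> f = f'.
Proof.
move=> [h [j [k [ej ek ehj efk]]]] [h' [j' [k' [ej' ek' ehj' efk']]]].
have ekk : k = k' by apply: (@lmono _ _ _ _ _ _ (incl (chull P))); rewrite ek.
have ejj : j = j' by apply: (@lmono _ _ _ _ _ _ (incl (chull P))); rewrite ej.
subst k' j'; rewrite -(extension_uniq ej ehj ehj') -efk in efk'.
by apply: lmono (esym efk').
Qed.

Lemma transporter_hull P R x : x \in transporter (i @* val P) (i @* val R) ->
  i @* val (chull P) :^ x^-1 \subset i @* val (chull R).
Proof.
rewrite inE => Tx; have NQ : x^-1 \in 'N(i @* val Q).
  by rewrite (subsetP (normal_norm (model_normal FG conG nQ))) ?inE.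
rewrite /= -[val P <*> val Q]/(<<_>>) morphim_gen ?subsetT // -genJ gen_subG.
rewrite morphimU conjUg subUset (normP NQ) (morphimS _ (joing_subr _ _)) andbT.
exact: subset_trans Tx (morphimS _ (joing_subl _ _)).
Qed.

(** As [Q] is normal in [G], conjugation by [x^-1] carries PQ into RQ. So [phi x] extends to PQ by
    [lextend], and the extension restricts to a morphism from [P] to [R]. *)
Lemma lrel_exists P R x : x \in transporter (i @* val P) (i @* val R) ->
  exists f : mor L P R, lrel f x.
Proof.
move=> Tx; have [j [k [ej ek kE]]] := chull_incl P.
have [|c cE] := @conj_model _ _ _ e (val (chull P)) x^-1.
  by apply: subset_trans (transporter_hull Tx) _; rewrite morphimS ?subsetT.
have FFc := model_inF FG cE.
have [|h eh] := lextend (P := chull P) (h := phi x) (joing_subr (val P) (val Q)) FFc _ ej.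
  move=> u Qu; apply: injI; rewrite -cE ?(subsetP (joing_subr (val P) (val Q))) //.
  rewrite -(lact_restrict nQ (phi x) Qu).
  by rewrite (lact_extension (j := Defs.cid L Q) (x := x)) ?ccompf1.
have [|f ef _] := @lrestrict _ _ _ _ nQ P R (h \oL k).
  move=> s Ps; rewrite lact_comp kE // -(mem_semb e) (lact_extension ej eh).
    by move: Tx; rewrite inE => /subsetP; apply; rewrite memJ_conjg mem_semb.
  by apply: (subsetP (joing_subl (val P) (val Q))).
by exists f, h, j, k.
Qed.

Lemma lrel_comp P R T (f : mor L P R) (g : mor L R T) x y :
  lrel f x -> lrel g y -> lrel (g \oL f) (y * x).
Proof.
move=> fx; have Tx := lrel_transporter fx; move: fx.
move=> [h [j [k [ej ek ehj efk]]]] [h' [j' [k' [ej' ek' ehj' egk']]]].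
(* The extension of [f] takes values in RQ, where it can be composed with the extension of [g]. *)
have [|h0 eh0 _] := @lrestrict _ _ _ _ nQ (chull P) (chull R) h.
  move=> s Hs; rewrite -(mem_semb e) (lact_extension ej ehj) //.
  by rewrite (subsetP (transporter_hull Tx)) // memJ_conjg mem_semb.
exists (h' \oL h0), j, k; split=> //.
  have ej0 : h0 \oL j = j' \oL phi x.
    by apply: (@lmono _ _ _ _ _ _ (incl (chull R))); rewrite !ccompA eh0 ehj ej'.
  by rewrite -ccompA ej0 ccompA ehj' phiM ccompA.
have ek0 : h0 \oL k = k' \oL f.
  by apply: (@lmono _ _ _ _ _ _ (incl (chull R))); rewrite !ccompA eh0 -efk ek'.
by rewrite -ccompA ek0 !ccompA egk'.
Qed.

Lemma lrel_ldel P s : s \in val P -> lrel (ldel L P s) (i s).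
Proof.
move=> Ps; have [j [k [ej ek _]]] := chull_incl P.
exists (ldel L St s \oL incl (chull P)), j, k; split=> //.
  by rewrite -ccompA ej -lextE phi_i.
by rewrite -ccompA ek ldel_natural // lact_lincl.
Qed.

Lemma lrel_cid P : lrel (Defs.cid L P) 1.
Proof. by rewrite -ldel1 -(morph1 i); apply: lrel_ldel. Qed.

(** An element of [G] inducing the image of [f] in [F] gives a morphism differing from [f] by Z(P),
    and Z(P) is realized in [G]. *)
Lemma lrel_total P R (f : mor L P R) : exists x, lrel f x.
Proof.
have [y fy] := model_realize FG (lact_inF f).
have [|f0 f0y] := @lrel_exists P R y^-1.
  rewrite inE invgK; apply/subsetP=> _ /imsetP[_ /morphimP[s _ Ps ->] ->].
  by rewrite fy // mem_semb lact_mem.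
have [s Ps|z Zz ->] := @lact_eq _ _ _ _ _ f0 f.
  by apply: injI; rewrite (lrel_lact f0y) // invgK fy.
have [Pz _] := setIP Zz.
by exists (y^-1 * i z); apply: lrel_comp (lrel_ldel Pz) f0y.
Qed.

(* The elements of C_G(P) act on P in L through a homomorphism to Z(P), which kills
   those of order prime to p. *)
Lemma lrel_Op_upper P x : x \in Op_upper p 'C(i @* val P) -> lrel (Defs.cid L P) x.
Proof.
pose W := [set x | `[< lrel (Defs.cid L P) x >]].
have WP x1 : reflect (lrel (Defs.cid L P) x1) (x1 \in W) by rewrite inE; apply: asboolP.
have gW : group_set W.
  apply/group_setP; split=> [|x1 y1 /WP Wx /WP Wy]; first exact/WP/lrel_cid.
  by apply/WP; rewrite -(ccomp1f (Defs.cid L P)); apply: lrel_comp.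
suffices /subsetP sKW : Op_upper p 'C(i @* val P) \subset Group gW by move/sKW/WP.
rewrite gen_subG; apply/subsetP=> {}x; rewrite inE => /andP[Cx p'x].
have [|f fx] := @lrel_exists P P x.
  by rewrite inE (normP _) // groupV (subsetP (cent_sub _)).
have [s Ps|z Zz def_f] := @lact_eq _ _ _ _ _ (Defs.cid L P) f.
  apply: injI; rewrite lact_cid // (lrel_lact fx) //; apply/esym/conjg_fixP/commgP/commute_sym.
  by apply: (centP (groupVr Cx)); rewrite mem_semb.
have [Pz _] := setIP Zz; rewrite ccomp1f in def_f; rewrite def_f in fx.
have zx n : lrel (ldel L P (z ^+ n)) (x ^+ n).
  elim: n => [|n IHn]; first by rewrite !expg0 ldel1; apply: lrel_cid.
  by rewrite !expgS ldelM ?groupX //; apply: lrel_comp.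
(* At the order of [x], both [ldel L P (z ^+ n)] and the identity are related to 1, so uniqueness
   applies. This order is prime to p, while [z] is a p-element. *)
have zn : z ^+ #[x] = 1.
  have := zx #[x]; rewrite expg_order => /lrel_uniq/(_ (lrel_cid P)) zn.
  apply: (ldel_free_l (f := Defs.cid L P)); rewrite ?groupX //.
  by rewrite zn ldel1.
have z1 : z = 1.
  apply/eqP; rewrite -order_eq1; apply/eqP; apply: (@pnat_1 p).
    exact: mem_p_elt pS (in_setT z).
  by apply: pnat_dvd p'x; rewrite order_dvdn zn.
by apply/WP; rewrite -ldel1 -z1.
Qed.

(** Write x^-1 y in C(P) as z k with [z] in Z(P) and [k] in O^p(C(P)). Then [f] and its composite
    with [ldel L P z] are both related to [y], so [z = 1]. *)
Lemma lrel_class P R (f : mor L P R) x y : lrel f x -> lrel f y ->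
  x^-1 * y \in Op_upper p 'C(i @* val P).
Proof.
move=> fx fy; have : x^-1 * y \in 'C(i @* val P).
  apply/centP=> _ /morphimP[s _ Ps ->]; apply/commute_sym/commgP/conjg_fixP.
  have := lrel_lact fx Ps; rewrite (lrel_lact fy Ps) => exy.
  by rewrite conjgM -[i s ^ _]exy; rewrite conjgKV.
have [defC _] := centric_Op FG (valP P).
rewrite -{1}defC; case/mulsgP=> _ k /setIP[/morphimP[z _ Pz ->] Cz] Kk exy.
have Zz : z \in 'Z(val P).
  rewrite inE Pz; apply/centP=> v Pv; apply: injI; rewrite !morI.
  by apply: (centP Cz); rewrite mem_semb.
have def_y : y = x * i z * k by rewrite -mulgA -exy mulKVg.
have := lrel_comp (lrel_Op_upper Kk) (lrel_comp (lrel_ldel Pz) fx).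
rewrite -def_y ccompf1 => /lrel_uniq/(_ fy)/(ldel_free Zz) z1.
by rewrite exy z1 morph1 mul1g.
Qed.

Lemma model_linking_iso : linking_iso L (LSG FG).
Proof.
pose rep P R (f : mor L P R) := projT1 (cid (lrel_total f)).
have repP P R (f : mor L P R) : lrel f (rep P R f) by apply: projT2 (cid (lrel_total f)).
pose Phi P R (f : mor L P R) : mor (LSG FG) P R := LG_class (lrel_transporter (repP P R f)).
(* The class is independent of the chosen element, so functoriality can be checked on convenient
   ones. *)
have PhiE P R (f : mor L P R) x (fx : lrel f x) : Phi P R f = LG_class (lrel_transporter fx).
  by apply/LG_class_eq; apply: lrel_class fx.
have Phi_id P : Phi P P (Defs.cid L P) = Defs.cid (LSG FG) P.
  rewrite (PhiE _ _ _ _ (lrel_cid P)); apply/LG_class_eq.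
  by rewrite mulg1 invg1 group1.
have Phi_comp P R T (g : mor L R T) (f : mor L P R) :
    Phi P T (g \oL f) = ccomp (Phi R T g) (Phi P R f).
  rewrite (PhiE _ _ _ _ (lrel_comp (repP _ _ f) (repP _ _ g))) /= LG_compE.
  by apply/LG_class_eq; rewrite mulVg group1.
apply: (@linking_functor_bij _ _ _ _ (Functor Phi_id Phi_comp)) => [P R f | P s] /=.
  apply: val_inj; rewrite LG_piE; apply/esym/cmap_uniq => [|u].
    exact: lrel_transporter (repP P R f).
  by rewrite -(lrel_lact (repP P R f)) ?subgP // /lact sgvalK.
have fs : lrel (ldelta L s) (i (sgval s)).
  by have := lrel_ldel (subgP s); rewrite /ldel sgvalK.
by rewrite (PhiE _ _ _ _ fs); apply/LG_class_eq; rewrite mulVg group1.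
Qed.

End ModelLinking.

Theorem proposition4p3 (p : nat) (S : finGroupType) (F : fusion_system S)
    (p_pr : prime p) (pS : p.-group [set: S])
    (satF : saturated F p) (constrF : constrained F) :
  [/\ (exists (G : finGroupType) (e : sylow_embedding p S G),
         [/\ p'_reduced p G, p_constrained p G & fusion_eq F (FSG e)]),
      (forall (G G' : finGroupType)
              (e : sylow_embedding p S G) (e' : sylow_embedding p S G'),
         p'_reduced p G -> p_constrained p G -> fusion_eq F (FSG e) ->
         p'_reduced p G' -> p_constrained p G' -> fusion_eq F (FSG e') ->
         [set: G] \isog [set: G'])
    & (forall (G : finGroupType) (e : sylow_embedding p S G)
              (FG : fusion_eq F (FSG e)),
         p'_reduced p G -> p_constrained p G ->
         forall L : linking_system F,
           (forall Q : cobj F, fnormal F (val Q) -> isog_Aut G L Q)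
           /\ linking_iso L (LSG FG))].
Proof.
have [Q [cQ nQ]] := constrF; pose Qc : cobj F := exist _ Q cQ.
split=> [|G G' e e' redG conG FG redG' conG' FG'|G e FG redG conG L].
- have [X [T]] := regular_torsor satF cQ nQ.
  exact: torsor_model pS satF cQ nQ T.
(* Uniqueness follows from part (a): both groups are Aut(Q) in one linking system, that of [G']. *)
- have [t [tM t_inj t_iso]] :=
    model_isog_Aut FG pS satF redG conG (LSG FG') (Q := Qc) nQ.
  have [t' [tM' t_inj' t_iso']] :=
    model_isog_Aut FG' pS satF redG' conG' (LSG FG') (Q := Qc) nQ.
  have [|f ef] := @choice G G' (fun x y => t' y = t x).
    by move=> x; apply/t_iso'/t_iso; exists x.
  have fM : {in [set: G] &, {morph f : x y / x * y}}.
    by move=> x y _ _; apply: t_inj'; rewrite tM' !ef tM.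
  apply/isogP; exists (Morphism fM).
    by apply/injmP=> x y _ _ /= exy; apply: t_inj; rewrite -!ef exy.
  apply/eqP; rewrite -subTset; apply/subsetP=> y _.
  have [x ex] : exists x, t x = t' y by apply/t_iso/t_iso'; exists y.
  by apply/morphimP; exists x; rewrite ?inE //=; apply: t_inj'; rewrite ef.
split=> [R nR|]; first exact: (model_isog_Aut FG pS satF redG conG L nR).
have [phi [phiM phi_i phi_inj _]] := model_linking_map FG pS satF redG conG L (Q := Qc) nQ.
exact: (model_linking_iso FG pS conG phiM phi_i phi_inj).
Qed.
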